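(* Let $n,h\in\mathbb N$ with $n\ge h$, and let $\mathcal G$ be the step-two group on $\mathbb R^{2n}\times\mathbb R^h$ described in the context, with indices $i_1,\dots,i_h$ and invertible matrix $A$ as there. Let $d\in C^\infty(\mathcal G\setminus\{0\})$ be a homogeneous norm, $p\ge2$, $\theta\in\mathbb R$, and set \[ Z_d=\frac{z}{d}+\sum_{k=1}^h\frac{\mathbf z^{(i_k)}}{d}-2p\theta\sum_{j,k=1}^h(A^{-1})_{jk}\,\frac{t_j}{d^2}\,\nabla^\perp_{2i_k-1,2i_k}d . \] Then for every $u\in C_c^\infty(\mathcal G\setminus\{0\})$, \[ \int_{\mathcal G}\frac{|\langle\nabla_{\mathcal G}u,Z_d\rangle|^p}{d^{p(\theta-1)}}\,dz\,dt\ge\left|\frac{Q-p\theta}{p}\right|^p\int_{\mathcal G}\frac{|u|^p}{d^{p\theta}}\,dz\,dt . \]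
   Context: Let $B^{(1)},\dots,B^{(h)}\in\mathbb R^{2n\times2n}$ be linearly independent, pairwise commuting skew-symmetric matrices, in the block form $B^{(j)}=\mathrm{diag}\left(\begin{pmatrix}0&\lambda^{(j)}_1\\-\lambda^{(j)}_1&0\end{pmatrix},\dots,\begin{pmatrix}0&\lambda^{(j)}_n\\-\lambda^{(j)}_n&0\end{pmatrix}\right)$ with $\lambda^{(j)}_i\ge0$. $\mathcal G$ is $\mathbb R^{2n}\times\mathbb R^h$ with coordinates $(z,t)$, group law $(z,t)\circ(\eta,\tau)=(z+\eta,t+\tau+\tfrac12(\langle B^{(1)}z,\eta\rangle,\dots,\langle B^{(h)}z,\eta\rangle))$, dilations $\delta_\gamma(z,t)=(\gamma z,\gamma^2t)$, homogeneous dimension $Q=2n+2h$. Horizontal fields $X_{2i-1}=\partial_{z_{2i-1}}+\sum_j\frac{\lambda^{(j)}_i}{2}z_{2i}\partial_{t_j}$, $X_{2i}=\partial_{z_{2i}}-\sum_j\frac{\lambda^{(j)}_i}{2}z_{2i-1}\partial_{t_j}$, $\nabla_{\mathcal G}u=(X_1u,\dots,X_{2n}u)$; horizontal vector fields are identified with $\mathbb R^{2n}$-valued functions via this basis. Indices $i_1,\dots,i_h\in\{1,\dots,n\}$ are chosen so that the $h\times h$ matrix $A$ with entries $A_{kj}=\lambda^{(j)}_{i_k}$ is invertible. $\mathbf z^{(i)}=(0,\dots,0,z_{2i-1},z_{2i},0,\dots,0)$ and $\nabla^\perp_{2i-1,2i}u=(0,\dots,0,-X_{2i}u,X_{2i-1}u,0,\dots,0)$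 (nonzero entries in positions $2i-1,2i$). A homogeneous norm is a continuous $d\ge0$ with $d(\delta_\lambda(z,t))=\lambda d(z,t)$, $d>0$ off the origin, and $d((z,t)\circ(\eta,\tau))\le d(z,t)+d(\eta,\tau)$. *)

(* Defs.v *)
From HB Require Import structures.
From mathcomp Require Import all_boot all_order all_algebra.
From mathcomp Require Import all_classical all_reals all_analysis.
Set Implicit Arguments. Unset Strict Implicit. Unset Printing Implicit Defensive.
Import Order.TTheory GRing.Theory Num.Theory.
Import numFieldNormedType.Exports.
Local Open Scope classical_set_scope.
Local Open Scope ring_scope.

Section Step2.
Variable R : realType.

(* Points of G = R^{2n} x R^h are row vectors x : 'rV[R]_(2*n+h);
   z = lsubmx x (coordinates z_1..z_{2n} are 0-based indices 0..2n-1),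
   t = rsubmx x.  Data: L : 'M[R]_(h,n) with  L j i = lambda^{(j)}_i
   (0-based j, i). *)
Definition zc n h (x : 'rV[R]_(2 * n + h)) : 'rV[R]_(2 * n) := lsubmx x.
Definition tc n h (x : 'rV[R]_(2 * n + h)) : 'rV[R]_h := rsubmx x.

(* lambda^{(j)}_k for a natural index k (0 if k >= n) *)
Definition lamN n h (L : 'M[R]_(h, n)) (j : 'I_h) (k : nat) : R :=
  \sum_(i < n | val i == k) L j i.

(* B^{(j)} : block diagonal with blocks [[0, l_i], [-l_i, 0]];
   1-based rows/cols 2i-1, 2i are 0-based 2i, 2i+1. *)
Definition Bmat n h (L : 'M[R]_(h, n)) (j : 'I_h) : 'M[R]_(2 * n) :=
  \matrix_(a, b)
    (if (val b == (val a).+1) && ~~ odd a then lamN L j (a %/ 2)%N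
     else if (val a == (val b).+1) && ~~ odd b then - lamN L j (b %/ 2)%N
     else 0).

Definition bform n h (L : 'M[R]_(h, n)) (j : 'I_h) (z w : 'rV[R]_(2 * n)) : R :=
  (z *m (Bmat L j)^T *m w^T) ord0 ord0.

Definition gmul n h (L : 'M[R]_(h, n)) (x y : 'rV[R]_(2 * n + h))
  : 'rV[R]_(2 * n + h) :=
  row_mx (zc x + zc y)
         (tc x + tc y + \row_j (2^-1 * bform L j (zc x) (zc y))).

Definition dil n h (g : R) (x : 'rV[R]_(2 * n + h)) : 'rV[R]_(2 * n + h) :=
  row_mx (g *: zc x) (g ^+ 2 *: tc x).

Definition hom_norm n h (L : 'M[R]_(h, n)) (d : 'rV[R]_(2 * n + h) -> R) :=
  continuous d /\
  (forall x, 0 <= d x) /\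
  (forall g x, 0 < g -> d (dil g x) = g * d x) /\
  (forall x, x != 0 -> 0 < d x) /\
  (forall x y, d (gmul L x y) <= d x + d y).

Fixpoint dpart N (s : seq 'I_N) (f : 'rV[R]_N -> R) : 'rV[R]_N -> R :=
  match s with
  | [::] => f
  | k :: s' => fun x => derive (dpart s' f) x (delta_mx ord0 k)
  end.

Definition smooth_on N (U : set 'rV[R]_N) (f : 'rV[R]_N -> R) :=
  open U /\ forall (s : seq 'I_N) x, U x -> differentiable (dpart s f) x.

Definition smooth_c N (U : set 'rV[R]_N) (f : 'rV[R]_N -> R) :=
  smooth_on U f /\
  exists K : set 'rV[R]_N, [/\ compact K, K `<=` U & forall x, ~ K x -> f x = 0].

Definition pz n h (m : 'I_(2 * n)) (u : 'rV[R]_(2 * n + h) -> R) x : R :=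
  derive u x (row_mx (delta_mx ord0 m) 0).
Definition pt n h (j : 'I_h) (u : 'rV[R]_(2 * n + h) -> R) x : R :=
  derive u x (row_mx 0 (delta_mx ord0 j)).

(* horizontal fields: X_m = d_{z_m} + sum_j (1/2) (B^{(j)} z)_m d_{t_j};
   this is exactly the formula of the paper for X_{2i-1}, X_{2i}. *)
Definition Xf n h (L : 'M[R]_(h, n)) (m : 'I_(2 * n))
  (u : 'rV[R]_(2 * n + h) -> R) x : R :=
  pz m u x + \sum_(j < h) (2^-1 * (zc x *m (Bmat L j)^T) ord0 m) * pt j u x.

Definition Xn n h (L : 'M[R]_(h, n)) (k : nat) (u : 'rV[R]_(2 * n + h) -> R) x : R :=
  \sum_(m < 2 * n | val m == k) Xf L m u x.

Definition gradG n h (L : 'M[R]_(h, n)) (u : 'rV[R]_(2 * n + h) -> R) x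
  : 'rV[R]_(2 * n) := \row_m Xf L m u x.

Definition zblock n h (i : 'I_n) (x : 'rV[R]_(2 * n + h)) : 'rV[R]_(2 * n) :=
  \row_m (if (m %/ 2)%N == val i then zc x ord0 m else 0).

Definition perp n h (L : 'M[R]_(h, n)) (i : 'I_n) (u : 'rV[R]_(2 * n + h) -> R) x
  : 'rV[R]_(2 * n) :=
  \row_m (if val m == (2 * i)%N then - Xn L (2 * i).+1 u x
          else if val m == (2 * i).+1 then Xn L (2 * i)%N u x else 0).

Definition Amat n h (L : 'M[R]_(h, n)) (ik : 'I_h -> 'I_n) : 'M[R]_h :=
  \matrix_(k, j) L j (ik k).

Definition Zd n h (L : 'M[R]_(h, n)) (ik : 'I_h -> 'I_n) (p theta : R)
  (d : 'rV[R]_(2 * n + h) -> R) x : 'rV[R]_(2 * n) :=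
  (d x)^-1 *: zc x + \sum_(k < h) (d x)^-1 *: zblock (ik k) x
  - (2 * p * theta) *:
      \sum_(j < h) \sum_(k < h)
         ((invmx (Amat L ik) j k) * tc x ord0 j / (d x) ^+ 2) *: perp L (ik k) d x.

Definition hdot N (a b : 'rV[R]_N) : R := (a *m b^T) ord0 ord0.

(* Integral over R^N with respect to Lebesgue measure, computed as an
   iterated integral of Lebesgue integrals on R (all integrands used below
   are continuous with compact support, so by Fubini this equals the
   integral for the N-dimensional Lebesgue measure). *)
Fixpoint intRN (N : nat) : ('rV[R]_N -> R) -> R :=
  match N return ('rV[R]_N -> R) -> R with
  | 0 => fun f => f 0
  | N'.+1 => fun f =>
      (\int[lebesgue_measure]_(a in setT)
          intRN (fun v : 'rV[R]_N' => f (row_mx (\row_(_ < 1) a) v)))%R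
  end.

End Step2.

(* Main.v *)
Require Import Defs.
From HB Require Import structures.
From mathcomp Require Import all_boot all_order all_algebra.
From mathcomp Require Import all_classical all_reals all_analysis.
From mathcomp Require Import ring lra zify.
Import Order.TTheory GRing.Theory Num.Theory.
Import numFieldNormedType.Exports.
Local Open Scope classical_set_scope.
Local Open Scope ring_scope.

(** With [w = d^(-p theta)], the vector field [W = w d Z_d] becomes
    [w (z + sum_k z^(i_k)) + 2 sum_jk (A^-1)_jk t_j perp_(i_k) w], and its
    horizontal divergence is exactly [(Q - p theta) w]: the commutators
    [[X_2i, X_(2i-1)] = sum_j lambda_i^(j) d/dt_j] turn the last sum into
    [2 sum_j t_j dw/dt_j], the terms produced by [z^(i_k)] cancel against those
    produced by [grad t_j], and Euler's identity for the homogeneous [w]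
    concludes.  Hence [|u|^p W] is a compactly supported C^1 field whose
    divergence integrates to zero, and a suitable multiple of that divergence
    bounds the difference of the two integrands from below, by Young's
    inequality. *)

Set Implicit Arguments.
Unset Strict Implicit.
Unset Printing Implicit Defensive.

(** * The iterated integral on continuous functions with bounded support *)

Section IteratedIntegral.
Context {R : realType}.

(** The multiple of the divergence comes from the tangent line behind Young's inequality. With
    [k = (Q - p theta) / p], the tangent to [s^p] is taken at [|k| |u| d^(-theta)], and
    [sg k |k|^(p-1)] is the factor for which the [|u|^p] terms add up to the constant term of that
    tangent. The comparison is therefore pointwise: no Hoelder inequality, no division by an
    integral, no separate case [k = 0]. The field is rewritten through [w] because it then becomes
    linear in [w], with [theta] entering only as the degree of homogeneity. As [|u|^p] need not be
    smooth, products with it are tracked only up to C^1, and the only second derivatives entering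
    the computation are those of [w]. Each coordinate derivative integrates to zero at its own level
    of the iterated integral, so the order of integration is never exchanged. The price is that
    inner integrals must be shown continuous, linear and differentiable in the outer variable, which
    rests on uniform continuity. *)

Definition supported N (f : 'rV[R]_N -> R) (M : R) :=
  forall x, M < `|x| -> f x = 0.

Definition cont_supported N (f : 'rV[R]_N -> R) (M : R) :=
  continuous f /\ supported f M.

Lemma near_dist (V : normedModType R) (v : V) (r : R) :
  0 < r -> \forall w \near v, `|v - w| < r.
Proof. by move=> r0; apply/nbhs_normP; exists r. Qed.

Lemma continuousP_dist (V : normedModType R) (f : V -> R) :
  (forall x e, 0 < e -> \forall y \near x, `|f x - f y| < e) -> continuous f.
Proof. by move=> cf x; apply/cvgrPdist_lt => e e0; exact: cf. Qed.

Lemma compact_norm_le N (M : R) : compact [set x : 'rV[R]_N | `|x| <= M].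
Proof.
apply: bounded_closed_compact.
  exists M; split; first exact: num_real.
  by move=> r Mr x /= xM; rewrite (le_trans xM)// ltW.
have -> : [set x : 'rV[R]_N | `|x| <= M] =
    (fun x => `|x|) @^-1` [set r : R | r <= M] by [].
by apply: preimage_closed; [move=> x _; exact: norm_continuous|exact: closed_le].
Qed.

(** Compactness of a ball gives one radius for all its points; beyond that ball two close points
    both lie outside the support. *)
Lemma cont_supported_unif N (f : 'rV[R]_N -> R) M : cont_supported f M ->
  forall e, 0 < e ->
  exists2 r, 0 < r & forall x y, `|x - y| < r -> `|f x - f y| < e.
Proof.
move=> [cf sf] e e0.
(* The margin 1 guarantees that a point within distance 1 of the outside of this ball is still
   outside the ball of radius [M]. *)
have /compact_near_coveringP cov := @compact_norm_le N (M + 1).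
have [|r /= r0 rP] := cov R 0^'+ (fun r x => forall y, `|x - y| < r -> `|f x - f y| < e) _.
  move=> x _.
  have /cvgrPdist_lt/(_ (e / 2)) := cf x; rewrite divr_gt0// => /(_ isT).
  move=> /nbhs_normP[s /= s0 sP].
  have s20 : 0 < s / 2 by rewrite divr_gt0.
  exists (ball x (s / 2), `]-oo, s / 2[%classic) => /=.
    split; first exact: nbhsx_ballx.
    by apply: nbhs_right_lt.
  move=> [x' r] /= []; rewrite -ball_normE/= in_itv/= => xx' rs y x'y.
  have fx' : `|f x - f x'| < e / 2.
    by apply: sP => /=; rewrite (lt_trans xx')// ltr_pdivrMr// ltr_pMr// ltr1n.
  have fy : `|f x - f y| < e / 2.
    apply: sP => /=; rewrite -(subrKA x') (le_lt_trans (ler_normD _ _))//.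
    by rewrite [ltRHS]splitr ltrD// (lt_trans x'y).
  rewrite -(subrKA (f x)) (le_lt_trans (ler_normD _ _))// [ltRHS]splitr ltrD//.
  by rewrite distrC.
pose s := Num.min (r / 2) 1.
have s0 : 0 < s by rewrite lt_min divr_gt0//=.
have sr : s / 2 < r.
  by rewrite (@lt_le_trans _ _ s)// ?ltr_pdivrMr ?ltr_pMr ?ltr1n// ge_min ler_pdivrMr// ler_peMr ?ler1n// ltW.
exists (s / 2); first by rewrite divr_gt0.
have := rP (s / 2); rewrite /= sub0r normrN gtr0_norm ?divr_gt0// => /(_ sr isT) fK x y xy.
have [xM|Mx] := leP `|x| (M + 1); first exact: fK.
rewrite !sf ?subrr ?normr0//; last by rewrite (lt_trans _ Mx)// ltrDl.
have s1 : s / 2 < 1.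
  by rewrite ltr_pdivrMr// mul1r (@le_lt_trans _ _ 1) ?ltr1n// ge_min lexx orbT.
have := ler_distD y x 0; rewrite !subr0; move: xy s1 Mx; lra.
Qed.

Lemma cont_supported_lin N (f g : 'rV[R]_N -> R) (c : R) M :
  cont_supported f M -> cont_supported g M ->
  cont_supported (fun x => f x + c * g x) M.
Proof.
move=> [cf sf] [cg sg]; split=> [x|x Mx]; last by rewrite sf// sg// mulr0 addr0.
have cgx : {for x, continuous (fun y => c * g y)}.
  exact: (continuousM (@cst_continuous _ _ _ _) (cg x)).
exact: (continuousD (cf x) cgx).
Qed.

Lemma integral_supp (g : R -> R) (M : R) : (forall a, M < `|a| -> g a = 0) ->
  (\int[lebesgue_measure]_(a in setT) g a
   = \int[lebesgue_measure]_(a in `[(- M), M]) g a)%R.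
Proof.
move=> g0; rewrite [RHS]Rintegral_mkcond; congr Rintegral; apply/funext => a.
rewrite patchE; case: ifPn => //; rewrite notin_setE/= in_itv/= -ler_norml.
by move=> /negP; rewrite -ltNge => /g0.
Qed.

Lemma integrable_supp (g : R -> R) (M : R) : continuous g ->
  (forall a, M < `|a| -> g a = 0) ->
  lebesgue_measure.-integrable setT (EFin \o g).
Proof.
move=> cg g0.
have -> : EFin \o g = (EFin \o g) \_ `[(- M), M].
  apply/funext => a; rewrite patchE; case: ifPn => //.
  rewrite notin_setE/= in_itv/= -ler_norml.
  by move=> /negP; rewrite -ltNge => /g0 ->.
apply: (integrable_mkcond _ _).1 => //; apply: continuous_compact_integrable.
  exact: segment_compact.
exact: continuous_subspaceT.
Qed.

Definition slice N (f : 'rV[R]_N.+1 -> R) (a : R) (v : 'rV[R]_N) : R :=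
  f (row_mx (\row_(_ < 1) a) v).

(** The norm is the maximum norm, so every slice of a function inherits its support radius [M], and
    a slice at [a] with [M < |a|] is identically zero. *)
Lemma norm_row_mx N (a : R) (v : 'rV[R]_N) :
  `|row_mx (\row_(_ < 1) a) v| = Num.max `|a| `|v|.
Proof.
apply/le_anti/andP; split.
  rewrite [leLHS]/Num.Def.normr/= mx_normrE; apply/bigmax_leP; split => /=.
    by rewrite le_max normr_ge0.
  move=> [i j] _ /=; rewrite (ord1 i) mxE; case: splitP => k _.
    by rewrite mxE le_max lexx.
  rewrite le_max; apply/orP; right.
  by rewrite [leRHS]/Num.Def.normr/= mx_normrE; apply/bigmax_geP; right; exists (ord0, k).
rewrite [leRHS]/Num.Def.normr/= mx_normrE ge_max; apply/andP; split.
  apply/bigmax_geP; right; exists (ord0, lshift N (ord0 : 'I_1)) => //=.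
  by rewrite row_mxEl mxE.
rewrite [leLHS]/Num.Def.normr/= mx_normrE; apply/bigmax_leP; split => /=.
  by apply/bigmax_geP; left.
move=> [i j] _ /=; apply/bigmax_geP; right; exists (ord0, rshift 1 j) => //=.
by rewrite row_mxEr (ord1 i).
Qed.

Lemma row_mx_consB N (a b : R) (v w : 'rV[R]_N) :
  row_mx (\row_(_ < 1) a) v - row_mx (\row_(_ < 1) b) w =
  row_mx (\row_(_ < 1) (a - b)) (v - w) :> 'rV_N.+1.
Proof.
by apply/matrixP => i j; rewrite !mxE; case: splitP => k _; rewrite !mxE.
Qed.

Lemma slice_cont_supported N (f : 'rV[R]_N.+1 -> R) M a :
  cont_supported f M -> cont_supported (slice f a) M.
Proof.
move=> cf; split; last first.
  by move=> v Mv; apply: cf.2; rewrite norm_row_mx lt_max Mv orbT.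
apply: continuousP_dist => v e e0.
have [r r0 rP] := cont_supported_unif cf e0.
apply: filterS (near_dist v r0) => w vw; apply: rP.
by rewrite row_mx_consB norm_row_mx subrr normr0 gt_max r0/=.
Qed.

Lemma intRN_ge0 N (f : 'rV[R]_N -> R) : (forall x, 0 <= f x) -> 0 <= intRN f.
Proof.
elim: N f => [|N IH] f f0 /=; first exact: f0.
by apply: Rintegral_ge0 => a _; apply: IH => v; exact: f0.
Qed.

Lemma intRN0 N : intRN (fun _ : 'rV[R]_N => 0 : R) = 0.
Proof.
elim: N => [//|N IH] /=.
by rewrite (_ : (fun _ => _) = fun=> 0) ?Rintegral_cst ?mul0r//; apply/funext => a.
Qed.

(** Linearity and the bound below are stated per dimension because they are proved by a joint
    induction: linearity one dimension up needs integrable slice integrals, hence continuous ones,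
    and that continuity uses both properties in the present dimension. *)
Definition intRN_linear N (M : R) := forall (f g : 'rV[R]_N -> R) (c : R),
  cont_supported f M -> cont_supported g M ->
  intRN (fun x => f x + c * g x) = intRN f + c * intRN g.

Definition intRN_bounded N (M : R) := forall (f : 'rV[R]_N -> R) (e : R),
  cont_supported f M -> (forall x, `|f x| <= e) ->
  `|intRN f| <= e * (2 * M) ^+ N.

(** Neighbouring slices are uniformly close; by linearity and the bound, so are their integrals. *)
Lemma continuous_intRN_slice N (M : R) : 0 <= M ->
  intRN_linear N M -> intRN_bounded N M -> forall f : 'rV[R]_N.+1 -> R,
  cont_supported f M -> continuous (fun a => intRN (slice f a)).
Proof.
move=> M0 IHl IHb f cf.
have IHD (g k : 'rV[R]_N -> R) : cont_supported g M -> cont_supported k M ->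
    intRN (fun x : 'rV_N => g x - k x) = intRN g - intRN k.
  move=> cg ck; rewrite -[in RHS]mulN1r -IHl//.
  by congr intRN; apply/funext => x; rewrite mulN1r.
apply: (@continuousP_dist R^o) => a e e0.
pose C := (2 * M) ^+ N + 1.
have C0 : 0 < C by rewrite ltr_wpDl// exprn_ge0// mulr_ge0.
have eC : 0 < e / C by rewrite divr_gt0.
have [r r0 rP] := cont_supported_unif cf eC.
apply: filterS (@near_dist R^o a r r0) => b ab.
have [[ca sa] [cb sb]] := (slice_cont_supported a cf, slice_cont_supported b cf).
rewrite -IHD// (@le_lt_trans _ _ (e / C * (2 * M) ^+ N))//; last first.
  by rewrite mulrAC ltr_pdivrMr// ltr_pM2l// /C ltrDl.
apply: IHb; last first.
  by move=> v; apply/ltW/rP; rewrite row_mx_consB norm_row_mx subrr normr0 gt_max r0 andbT.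
split=> [v|v Mv]; first exact: (continuousB (ca v) (cb v)).
by rewrite sa// sb// subrr.
Qed.

(** The factor [(2 * M) ^+ N] is the volume of the cube carrying the support. *)
Lemma intRN_linear_bounded N (M : R) : 0 <= M ->
  intRN_linear N M /\ intRN_bounded N M.
Proof.
move=> M0; elim: N => [|N [IHl IHb]].
  by split => [//|f e _ fe /=]; rewrite expr0 mulr1; exact: fe.
have csl := continuous_intRN_slice M0 IHl IHb.
have ssl : forall f : 'rV[R]_N.+1 -> R, cont_supported f M ->
    forall a : R, M < `|a| -> intRN (slice f a) = 0.
  move=> f [_ sf] a Ma; rewrite (_ : slice f a = fun=> 0) ?intRN0//.
  by apply/funext => v; apply: sf; rewrite norm_row_mx lt_max Ma.
have isl (f : 'rV[R]_N.+1 -> R) : cont_supported f M ->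
    lebesgue_measure.-integrable setT (EFin \o (fun a => intRN (slice f a))).
  move=> cf; apply: (@integrable_supp _ M); [exact: csl|exact: ssl].
split=> [f g c cf cg|f e cf fe] /=.
  rewrite -RintegralZl//; last exact: isl.
  rewrite -RintegralD//; last 2 first.
  - exact: isl.
  - have := integrableZl _ c (isl _ cg); apply; exact: measurableT.
  congr Rintegral; apply/funext => a.
  by rewrite -IHl; [|exact: slice_cont_supported..].
rewrite (integral_supp (ssl f cf)).
rewrite (le_trans (le_normr_Rintegral _ _))//.
  apply: integrableS (isl f cf) => //.
have -> : e * (2 * M) ^+ N.+1 = (\int[lebesgue_measure]_(x in `[(- M), M]) (e * (2 * M) ^+ N))%R.
  rewrite Rintegral_cst// /= lebesgue_measure_itv/= lte_fin.
  case: ltP => [MM|MM] /=.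
    by rewrite exprSr mulrA; congr (_ * _); ring.
  have -> : M = 0 by apply/eqP; rewrite eq_le M0 andbT; move: MM; lra.
  by rewrite mulr0 exprS !(mul0r,mulr0).
apply: le_Rintegral => //.
- apply: integrable_norm => //; apply: integrableS (isl f cf) => //.
- apply: continuous_compact_integrable; first exact: segment_compact.
  by apply: continuous_subspaceT => x; exact: cvg_cst.
- move=> a _; apply: IHb; first exact: slice_cont_supported.
  by move=> v; exact: fe.
Qed.

End IteratedIntegral.

(** * Vanishing of the integral of a coordinate derivative *)

Section IntegralOfDerivative.
Context {R : realType}.

Lemma is_derive_line (V : normedModType R) (f : V -> R) x v (r : R) :
  derivable f (x + r *: v) v ->
  is_derive r 1 (fun r : R => f (x + r *: v)) ('D_v f (x + r *: v)).
Proof.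
move=> df.
have E : (fun h : R => h^-1 *: ((fun r : R => f (x + r *: v)) (h *: 1 + r) - f (x + r *: v))) =
         (fun h : R => h^-1 *: (f (h *: v + (x + r *: v)) - f (x + r *: v))).
  apply/funext => h; congr (_ *: (f _ - _)).
  by rewrite scalerDl [h *: 1]mulr1 addrCA.
by split; [rewrite /derivable E|rewrite /derive E].
Qed.

Lemma derive_dirZ (V : normedModType R) (f : V -> R) x v (s : R) :
  differentiable f x -> 'D_(s *: v) f x = s * 'D_v f x.
Proof. by move=> df; rewrite !deriveE// linearZ. Qed.

Lemma derive_dirD (V : normedModType R) (f : V -> R) x v w :
  differentiable f x -> 'D_(v + w) f x = 'D_v f x + 'D_w f x.
Proof. by move=> df; rewrite !deriveE// linearD. Qed.

Lemma derive_dir_sum (V : normedModType R) (f : V -> R) x (I : finType) (v : I -> V) :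
  differentiable f x -> 'D_(\sum_i v i) f x = \sum_i 'D_(v i) f x.
Proof.
move=> df; rewrite deriveE// linear_sum.
by apply: eq_bigr => i _; rewrite deriveE.
Qed.

Lemma mean_value (V : normedModType R) (f : V -> R) x v (s : R) :
  (forall r : R, `|r| <= `|s| -> derivable f (x + r *: v) v) ->
  exists2 c : R, `|c| <= `|s| & f (x + s *: v) - f x = s * 'D_v f (x + c *: v).
Proof.
move=> df; pose phi r := f (x + r *: v).
have phi0 : phi 0 = f x by rewrite /phi scale0r addr0.
have dphi (r : R) : `|r| <= `|s| -> is_derive r 1 phi ('D_v f (x + r *: v)).
  by move=> /df; exact: is_derive_line.
have [s0|s0] := leP 0 s.
  have P (r : R) : r \in `[0, s] -> `|r| <= `|s|.
    by rewrite in_itv/= => /andP[r0 rs]; rewrite !ger0_norm.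
  have [||c /P cs] := @MVT_segment R phi (fun r => 'D_v f (x + r *: v)) 0 s s0.
  - by move=> r /subset_itv_oo_cc /P /dphi.
  - by apply: derivable_within_continuous => r /P/dphi dr; exact: ex_derive.
  by rewrite phi0 subr0 mulrC; exists c.
have P (r : R) : r \in `[s, 0] -> `|r| <= `|s|.
  rewrite in_itv/= => /andP[sr r0].
  by rewrite (ler0_norm r0) (ler0_norm (ltW s0)) lerN2.
have [||c /P cs] := @MVT_segment R phi (fun r => 'D_v f (x + r *: v)) s 0 (ltW s0).
- by move=> r /subset_itv_oo_cc /P /dphi.
- by apply: derivable_within_continuous => r /P/dphi dr; exact: ex_derive.
rewrite phi0 sub0r mulrN => E; exists c => //.
by rewrite -[LHS]opprB E opprK mulrC.
Qed.

Lemma supported_derive N (f : 'rV[R]_N -> R) M v :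
  supported f M -> supported ('D_v f) M.
Proof.
move=> sf x Mx; rewrite (@near_eq_derive _ _ _ f (cst 0)) ?derive_cst//.
have : 0 < `|x| - M by rewrite subr_gt0.
move=> /(near_dist x); apply: filterS => y xy; apply: sf.
by have := ler_distD y x 0; rewrite !subr0; move: xy; lra.
Qed.

(** The mean value theorem and uniform continuity of the derivative make the difference quotients
    converge uniformly in [x]; this is what justifies differentiation under the integral sign. *)
Lemma derive_unif N (f : 'rV[R]_N -> R) M v :
  (forall x, derivable f x v) -> cont_supported ('D_v f) M ->
  forall e : R, 0 < e -> exists2 r : R, 0 < r & forall (s : R) x, `|s| < r ->
    `|f (x + s *: v) - f x - s * 'D_v f x| <= e * `|s|.
Proof.
move=> df cDf e e0; have [r r0 rP] := cont_supported_unif cDf e0.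
exists (r / (`|v| + 1)); first by rewrite divr_gt0// ltr_wpDl.
move=> s x; rewrite ltr_pdivlMr ?ltr_wpDl// => sr.
have [|c cs ->] := @mean_value _ f x v s; first by move=> *; exact: df.
rewrite -mulrBr normrM mulrC ler_wpM2r//; apply/ltW/rP.
rewrite addrC addKr normrZ (le_lt_trans _ sr)// ler_pM// lerDl//.
Qed.

Lemma slice_lineE N (f : 'rV[R]_N.+1 -> R) (a h : R) (v w : 'rV[R]_N) :
  slice f a (h *: w + v) =
  f (h *: (row_mx (0 : 'rV_1) w : 'rV_N.+1) + (row_mx (\row_(_ < 1) a) v : 'rV_N.+1)).
Proof.
congr f; apply/matrixP => i j; rewrite !mxE.
by case: splitP => k _; rewrite !mxE ?mulr0 ?add0r.
Qed.

Lemma slice_quotientE N (f : 'rV[R]_N.+1 -> R) a (v w : 'rV[R]_N) :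
  (fun h => h^-1 *: ((slice f a \o shift v) (h *: w) - slice f a v)) =
  (fun h => h^-1 *: ((f \o shift (row_mx (\row_(_ < 1) a) v : 'rV_N.+1))
     (h *: (row_mx (0 : 'rV_1) w : 'rV_N.+1)) - f (row_mx (\row_(_ < 1) a) v))).
Proof. by apply/funext => h /=; rewrite slice_lineE. Qed.

Lemma derivable_slice N (f : 'rV[R]_N.+1 -> R) a v w :
  derivable f (row_mx (\row_(_ < 1) a) v : 'rV_N.+1) (row_mx (0 : 'rV_1) w : 'rV_N.+1) ->
  derivable (slice f a) v w.
Proof. by rewrite /derivable slice_quotientE. Qed.

Lemma derive_slice N (f : 'rV[R]_N.+1 -> R) a w :
  'D_w (slice f a) = slice ('D_(row_mx (0 : 'rV_1) w : 'rV_N.+1) f) a.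
Proof. by apply/funext => v; rewrite /derive slice_quotientE. Qed.

(** An inner coordinate is handled slice by slice. For the outermost one, the slice integral [G] has
    derivative [D], and the fundamental theorem of calculus applies between two points where [G] is
    zero. *)
Lemma intRN_derive_basis N (f : 'rV[R]_N -> R) (M : R) (k : 'I_N) : 0 <= M ->
  (forall x, derivable f x (delta_mx 0 k)) -> cont_supported f M ->
  continuous ('D_(delta_mx 0 k) f) -> intRN ('D_(delta_mx 0 k) f) = 0.
Proof.
move=> M0; elim: N f k => [|N IH] f k df cf cDf; first by case: k {df cDf} => [[]].
have csD : cont_supported ('D_(delta_mx 0 k) f) M.
  by split => //; exact: supported_derive cf.2.
rewrite /=; case: (unliftP ord0 k) => [k' kE|kE].
  have dE : delta_mx 0 k = row_mx (0 : 'rV_1) (delta_mx 0 k') :> 'rV[R]_N.+1.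
    apply/matrixP => i j; rewrite !mxE kE; case: splitP => l jl; rewrite !mxE.
      by rewrite (_ : j = ord0) ?andbF//; apply: val_inj => /=; rewrite jl ord1.
    congr ((_ && _)%:R); apply/eqP/eqP => [jE|lk].
      by apply: val_inj; move: jl; rewrite jE /= /bump/= => -[].
    by apply: val_inj; rewrite /= jl lk.
  rewrite (_ : (fun _ => _) = fun=> 0) ?Rintegral_cst ?mul0r//.
  apply/funext => a; transitivity (intRN ('D_(delta_mx 0 k') (slice f a))).
    by rewrite derive_slice -dE.
  apply: IH.
  - by move=> v; apply: derivable_slice; rewrite -dE; exact: df.
  - exact: slice_cont_supported.
  - by rewrite derive_slice -dE; exact: (slice_cont_supported a csD).1.
set G := fun a => intRN (slice f a); set D := fun a => intRN _.
have [lin bnd] := intRN_linear_bounded N M0.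
have shiftE (a s : R) (v : 'rV[R]_N) : slice f (s + a) v =
    f ((row_mx (\row_(_ < 1) a) v : 'rV_N.+1) + s *: delta_mx 0 k).
  congr f; apply/matrixP => i j; rewrite !mxE kE.
  case: splitP => l jl; rewrite ?mxE.
    rewrite (_ : j = ord0) ?eqxx ?(ord1 i)//= ?mulr1 1?addrC//.
    by apply: val_inj => /=; rewrite jl ord1.
  by rewrite (_ : j == ord0 = false) ?andbF ?mulr0 ?addr0//; apply/eqP => /(congr1 val); rewrite /= jl.
have cs a := slice_cont_supported a cf.
have csd a := slice_cont_supported a csD.
(* The remainder of [derive_unif] is at most [e / C * |s|] on every slice; integrating costs a
   factor [(2 * M) ^+ N], which is less than [C]. *)
have GD (a : R) : is_derive a 1 G (D a).
  have : (fun s : R => s^-1 *: (G (s *: 1 + a) - G a)) @ 0^' --> D a.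
    apply/cvgrPdist_le => e e0.
    pose C := (2 * M) ^+ N + 1.
    have C0 : 0 < C by rewrite ltr_wpDl// exprn_ge0// mulr_ge0.
    have [r r0 rP] := derive_unif df csD (divr_gt0 e0 C0).
    near=> s.
    have s0 : s != 0 by near: s; exact: nbhs_dnbhs_neq.
    have sr : `|s| < r by near: s; exact: dnbhs0_lt.
    have : `|G (s + a) - G a - s * D a| <= e / C * `|s| * (2 * M) ^+ N.
      have -> : G (s + a) - G a - s * D a =
          intRN (fun v => (slice f (s + a) v + (-1) * slice f a v)
                         + (- s) * slice ('D_(delta_mx 0 k) f) a v).
        rewrite lin// ?lin ?mulN1r ?mulNr//.
        exact: cont_supported_lin.
      apply: bnd; last first.
        by move=> v; rewrite mulN1r mulNr shiftE; exact: rP.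
      by do 2!apply: cont_supported_lin => //.
    move=> le1; rewrite [s *: 1]mulr1 distrC.
    have -> : s^-1 *: (G (s + a) - G a) - D a = s^-1 * (G (s + a) - G a - s * D a).
      by rewrite [RHS]mulrBr mulKf.
    rewrite normrM normfV ler_pdivrMl ?normr_gt0//.
    rewrite (le_trans le1)// mulrC [leRHS]mulrC mulrA ler_wpM2r//.
    by rewrite mulrCA ler_piMr ?ltW// ltr_pdivrMr// mul1r ltrDl.
  move=> cG; split; last by apply: (cvg_lim _ cG); exact: norm_hausdorff.
  by apply/cvg_ex; exists (D a).
have supp0 (g : 'rV[R]_N.+1 -> R) a : supported g M -> M < `|a| -> intRN (slice g a) = 0.
  move=> sg Ma; rewrite (_ : slice g a = fun=> 0) ?intRN0//.
  by apply/funext => v; apply: sg; rewrite norm_row_mx lt_max Ma.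
(* Radius [M + 1] rather than [M]: the interval is nondegenerate even for [M = 0], and its ends lie
   strictly outside the support. *)
rewrite (@integral_supp _ D (M + 1)); last first.
  by move=> a Ma; apply: (supp0 _ _ csD.2); rewrite (lt_trans _ Ma)// ltrDl.
have cG : continuous G.
  by move=> a; apply/differentiable_continuous/derivable1_diffP; have := GD a => ?; exact: ex_derive.
have cD : continuous D.
  by apply: continuous_intRN_slice csD.
have MM : - (M + 1) < M + 1 by move: M0; lra.
have G0 (a : R) : M + 1 <= `|a| -> G a = 0.
  by move=> Ma; apply: (supp0 _ _ cf.2); rewrite (lt_le_trans _ Ma)// ltrDl.
have M10 : 0 <= M + 1 by rewrite addr_ge0.
rewrite /Rintegral (@continuous_FTC2 _ D G) //=.
- by rewrite !G0 ?subrr// ?normrN ger0_norm.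
- exact: continuous_subspaceT.
- split=> [a _||]; first by have := GD a => ?; exact: ex_derive.
  + by apply: cvg_at_right_filter; exact: cG.
  + by apply: cvg_at_left_filter; exact: cG.
- by move=> a _; rewrite derive1E; have := GD a => ?; exact: derive_val.
Unshelve. all: by end_near. Qed.

End IntegralOfDerivative.

(** * Equality of mixed directional derivatives *)

Section MixedDerivatives.
Context {R : realType} {V : normedModType R}.

Lemma differentiable_bound (g : V -> R) x : differentiable g x ->
  forall e : R, 0 < e -> exists2 r : R, 0 < r & forall h, `|h| < r ->
    `|g (x + h) - g x - 'd g x h| <= e * `|h|.
Proof.
move=> dg e e0; have /eqaddoP/(_ e e0) := diff_locally dg.
move=> /nbhs_normP[r /= r0 rP]; exists r => // h hr.
have := rP h; rewrite /ball_/= sub0r normrN => /(_ hr).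
by rewrite !fctE/= opprD addrA (addrC h).
Qed.

(* The second difference [f (x + s a + s b) - f (x + s b) - f (x + s a) + f x]
   is symmetric in [a] and [b], so it determines both mixed derivatives. *)
Lemma second_difference (f : V -> R) x a b :
  (\forall y \near x, differentiable f y) -> differentiable ('D_a f) x ->
  forall e : R, 0 < e -> exists2 r : R, 0 < r & forall s : R, `|s| < r ->
    `|f (x + s *: a + s *: b) - f (x + s *: a) - f (x + s *: b) + f x
      - s * s * 'D_b ('D_a f) x| <= e * (s * s).
Proof.
move=> /nbhs_normP[r1 /= r10 r1P] dg e e0.
pose C := `|a| + `|b| + 1; have C0 : 0 < C by rewrite ltr_wpDl// addr_ge0.
have e2C : 0 < e / (2 * C) by rewrite divr_gt0// mulr_gt0.
have [r2 r20 r2P] := differentiable_bound dg e2C.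
exists (Num.min r1 r2 / C) => [|s]; first by rewrite divr_gt0// lt_min r10.
rewrite ltr_pdivlMr// lt_min => /andP[sr1 sr2].
have bd (c : R) (k : V) : `|c| <= `|s| -> k = 0 \/ k = s *: b ->
    `|c *: a + k| <= `|s| * C.
  move=> cs kE; rewrite (le_trans (ler_normD _ _))// normrZ.
  have : `|c| * `|a| <= `|s| * `|a| by rewrite ler_wpM2r.
  have : `|k| <= `|s| * `|b|.
    by case: kE => ->; rewrite ?normr0 ?mulr_ge0// normrZ.
  by rewrite /C !mulrDr mulr1; have := normr_ge0 s; lra.
(* The mean value theorem for [phi] along [a] turns the second difference into a difference of two
   values of ['D_a f]. In the first-order expansions of these at [x] the unknown intermediate point
   [c] cancels, leaving [s * 'D_b ('D_a f) x]. *)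
pose phi y := f (y + s *: b) - f y.
have dphi (c : R) : `|c| <= `|s| -> is_derive (x + c *: a) a phi
    ('D_a f (x + (c *: a + s *: b)) - 'D_a f (x + (c *: a + 0))).
  move=> cs; have d0 : differentiable f (x + (c *: a + 0)).
    apply: r1P => /=; rewrite opprD addNKr normrN (le_lt_trans _ sr1)//.
    by apply: bd => //; left.
  have d1 : differentiable f (x + (c *: a + s *: b)).
    apply: r1P => /=; rewrite opprD addNKr normrN (le_lt_trans _ sr1)//.
    by apply: bd => //; right.
  rewrite addr0 in d0 *; apply: is_deriveB; last exact/derivableP/diff_derivable.
  have E : (fun h : R => h^-1 *: (((fun y => f (y + s *: b)) \o shift (x + c *: a)) (h *: a) - f (x + c *: a + s *: b))) =
    (fun h => h^-1 *: ((f \o shift (x + (c *: a + s *: b))) (h *: a) - f (x + (c *: a + s *: b)))).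
    by apply/funext => h /=; rewrite !addrA.
  split; first by rewrite /derivable E; exact: diff_derivable.
  by rewrite /derive E.
have [c cs|c cs] := @mean_value _ _ phi x a s.
  by have ? := dphi c cs; exact: ex_derive.
have -> := @derive_val _ _ _ _ _ _ _ (dphi c cs).
rewrite /phi => E.
have -> : f (x + s *: a + s *: b) - f (x + s *: a) - f (x + s *: b) + f x =
  f (x + s *: a + s *: b) - f (x + s *: a) - (f (x + s *: b) - f x) by ring.
rewrite E -mulrA -mulrBr normrM.
have h1 : `|c *: a + s *: b| <= `|s| * C by apply: bd => //; right.
have h0 : `|c *: a + 0| <= `|s| * C by apply: bd => //; left.
have b1 := r2P _ (le_lt_trans h1 sr2).
have b0 := r2P _ (le_lt_trans h0 sr2).
have dE : s * 'D_b ('D_a f) x = 'd ('D_a f) x (c *: a + s *: b) - 'd ('D_a f) x (c *: a + 0).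
  by rewrite deriveE// -linearB addr0 addrC addKr linearZ.
have B1 : e / (2 * C) * `|c *: a + s *: b| <= e / (2 * C) * (`|s| * C).
  by rewrite ler_wpM2l// ltW.
have B0 : e / (2 * C) * `|c *: a + 0| <= e / (2 * C) * (`|s| * C).
  by rewrite ler_wpM2l// ltW.
have EC : e / (2 * C) * (`|s| * C) = e * `|s| / 2.
  by field; rewrite gt_eqF.
have -> : s * s = `|s| * `|s| by rewrite -!expr2 real_normK// num_real.
rewrite mulrCA ler_wpM2l// dE.
rewrite EC in B1 B0.
move: (le_trans b1 B1) (le_trans b0 B0).
set u : R := 'D_a f x; set u1 : R := 'D_a f _; set u0 : R := 'D_a f _.
set l1 : R := 'd _ _ _; set l0 : R := 'd _ _ _; move=> L1 L0.
have -> : u1 - u0 - (l1 - l0) = (u1 - u - l1) - (u0 - u - l0) by ring.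
rewrite (le_trans (ler_normB _ _))// (le_trans (lerD L1 L0))//.
by rewrite -splitr.
Qed.

Lemma derive_comm (f : V -> R) x a b :
  (\forall y \near x, differentiable f y) ->
  differentiable ('D_a f) x -> differentiable ('D_b f) x ->
  'D_b ('D_a f) x = 'D_a ('D_b f) x.
Proof.
move=> df da db; apply/eqP; rewrite -subr_eq0 -normr_le0; apply/ler_addgt0Pl => e e0.
rewrite addr0.
have e20 : 0 < e / 2 by rewrite divr_gt0.
have [r1 r10 r1P] := second_difference b df da e20.
have [r2 r20 r2P] := second_difference a df db e20.
pose s := Num.min r1 r2 / 2.
have s0 : 0 < s by rewrite divr_gt0// lt_min r10.
have ss : s < Num.min r1 r2.
  by rewrite ltr_pdivrMr// ltr_pMr ?ltr1n// lt_min r10.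
have [sr1 sr2] : `|s| < r1 /\ `|s| < r2.
  by apply/andP; rewrite gtr0_norm// -lt_min.
have := r2P _ sr2; have := r1P _ sr1.
rewrite (addrAC x (s *: b)).
set A := 'D_b _ _; set B := 'D_a _ _; set Fab := f (x + s *: a + s *: b).
set Fa := f (x + s *: a); set Fb := f (x + s *: b) => L1 L2.
have s20 : 0 < s * s by rewrite mulr_gt0.
rewrite -(ler_pM2l s20) -{1}(gtr0_norm s20) -normrM.
have -> : s * s * (A - B) = (Fab - Fb - Fa + f x - s * s * B) -
   (Fab - Fa - Fb + f x - s * s * A) by ring.
rewrite (le_trans (ler_normB _ _))// (le_trans (lerD L2 L1))//.
by rewrite -mulrDl -splitr mulrC.
Qed.

End MixedDerivatives.

(** * Continuously differentiable functions *)

Section ContinuouslyDifferentiable.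
Context {R : realType} {V : normedModType R}.
Implicit Types (U : set V) (f g : V -> R).

Definition C1 U f := forall x, U x ->
  differentiable f x /\ forall v, {for x, continuous ('D_v f)}.

Lemma near_eq_continuous f g x :
  (\forall y \near x, f y = g y) -> {for x, continuous f} -> {for x, continuous g}.
Proof.
move=> fg cf; have fgx : f x = g x := nbhs_singleton fg.
have : g @ x --> f x by apply: cvg_trans cf; exact: near_eq_cvg fg.
by rewrite fgx.
Qed.

Lemma C1_intro U f (D : V -> V -> R) : open U ->
  (forall x, U x -> differentiable f x) ->
  (forall x v, U x -> 'D_v f x = D v x) ->
  (forall x v, U x -> {for x, continuous (D v)}) -> C1 U f.
Proof.
move=> oU df fD cD x Ux; split=> [|v]; first exact: df.
apply: near_eq_continuous (cD x v Ux).
by apply: filterS (open_nbhs_nbhs (conj oU Ux)) => y Uy; rewrite fD.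
Qed.

Lemma C1_differentiable U f x : C1 U f -> U x -> differentiable f x.
Proof. by move=> C /C[]. Qed.

Lemma C1_derivable U f x v : C1 U f -> U x -> derivable f x v.
Proof. by move=> C Ux; exact/diff_derivable/(C1_differentiable C Ux). Qed.

Lemma C1_continuous U f x : C1 U f -> U x -> {for x, continuous f}.
Proof. by move=> C Ux; exact/differentiable_continuous/(C1_differentiable C Ux). Qed.

Lemma C1_continuous_derive U f x v : C1 U f -> U x -> {for x, continuous ('D_v f)}.
Proof. by move=> C /C[]. Qed.

Lemma C1D U f g : open U -> C1 U f -> C1 U g -> C1 U (f \+ g).
Proof.
move=> oU Cf Cg.
apply: (@C1_intro _ _ (fun v x => 'D_v f x + 'D_v g x)) => // [x Ux|x v Ux|x v Ux].
- exact: differentiableD (C1_differentiable Cf Ux) (C1_differentiable Cg Ux).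
- by rewrite -[f \+ g]/(f + g) (deriveD (C1_derivable (v := v) Cf Ux) (C1_derivable (v := v) Cg Ux)).
- exact: continuousD (C1_continuous_derive Cf Ux) (C1_continuous_derive Cg Ux).
Qed.

Lemma C1M U f g : open U -> C1 U f -> C1 U g -> C1 U (f \* g).
Proof.
move=> oU Cf Cg.
apply: (@C1_intro _ _ (fun v x => f x * 'D_v g x + g x * 'D_v f x)) => // [x Ux|x v Ux|x v Ux].
- exact: differentiableM (C1_differentiable Cf Ux) (C1_differentiable Cg Ux).
- by rewrite -[f \* g]/(f * g) (deriveM (C1_derivable (v := v) Cf Ux) (C1_derivable (v := v) Cg Ux)).
- have cfg := continuousM (C1_continuous Cf Ux) (C1_continuous_derive (v := v) Cg Ux).
  have cgf := continuousM (C1_continuous Cg Ux) (C1_continuous_derive (v := v) Cf Ux).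
  exact: (continuousD cfg cgf).
Qed.

Lemma C1_cst U (c : R) : open U -> C1 U (cst c).
Proof.
move=> oU; apply: (@C1_intro _ _ (fun _ => cst 0)) => // x v Ux.
  by rewrite derive_cst.
exact: cst_continuous.
Qed.

Lemma C1_sum U (I : finType) (f : I -> V -> R) : open U ->
  (forall i, C1 U (f i)) -> C1 U (fun x => \sum_i f i x).
Proof.
move=> oU Cf; elim: (index_enum I) => [|i s IH].
  by under [X in C1 U X]eq_fun do rewrite big_nil; exact: C1_cst.
by under [X in C1 U X]eq_fun do rewrite big_cons; apply: C1D.
Qed.

Lemma derive_comp (phi : R -> R) (dphi : R) f x v : differentiable f x ->
  is_derive (f x) 1 phi dphi -> 'D_v (phi \o f) x = dphi * 'D_v f x.
Proof.
move=> df [dp pE]; have dphi' : differentiable phi (f x) by exact/derivable1_diffP.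
rewrite deriveE; last exact: differentiable_comp.
rewrite diff_comp//= deriveE// -[X in 'd phi _ X]mulr1.
have dE : 'd phi (f x) 1 = dphi by rewrite -pE deriveE.
by rewrite -[_ * 1]/(_ *: 1) linearZ /= dE mulrC.
Qed.

Lemma C1_comp U (phi dphi : R -> R) f : open U ->
  (forall x, U x -> is_derive (f x) 1 phi (dphi (f x))) ->
  (forall x, U x -> {for f x, continuous dphi}) ->
  C1 U f -> C1 U (phi \o f).
Proof.
move=> oU dp cdp Cf.
apply: (@C1_intro _ _ (fun v x => dphi (f x) * 'D_v f x)) => // [x Ux|x v Ux|x v Ux].
- apply: differentiable_comp; first exact: C1_differentiable Cf Ux.
  by apply/derivable1_diffP; have := dp x Ux => ?; exact: ex_derive.
- by apply: derive_comp; [exact: C1_differentiable Cf Ux|exact: dp].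
- have c1 : {for x, continuous (dphi \o f)}.
    by apply: continuous_comp; [exact: C1_continuous Cf Ux|exact: cdp].
  exact: (continuousM c1 (C1_continuous_derive Cf Ux)).
Qed.

Lemma vanish_near (K : set V) f x : closed K -> (forall y, ~ K y -> f y = 0) ->
  ~ K x -> \forall y \near x, cst 0 y = f y.
Proof.
move=> cK f0 nKx.
have : nbhs x (~` K) by apply: open_nbhs_nbhs; split => //; exact: closed_openC.
by apply: filterS => y /f0 ->.
Qed.

Lemma vanish_derive (K : set V) f x v : closed K -> (forall y, ~ K y -> f y = 0) ->
  ~ K x -> 'D_v f x = 0.
Proof.
by move=> cK f0 nK; rewrite -(near_eq_derive _ (vanish_near cK f0 nK)) derive_cst.
Qed.

(** In the application [U] is the complement of the origin, where [d] is smooth and positive. A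
    function vanishing off a closed [K] inside [U] is locally zero near any point outside [K], the
    origin included, so regularity on [U] becomes global. *)
Lemma continuous_glue U (K : set V) f : closed K -> K `<=` U ->
  (forall y, ~ K y -> f y = 0) -> (forall x, U x -> {for x, continuous f}) ->
  continuous f.
Proof.
move=> cK KU f0 cf x; have [/KU/cf//|nKx] := pselect (K x).
by apply: near_eq_continuous (vanish_near cK f0 nKx) _; exact: cst_continuous.
Qed.

Lemma derivable_glue U (K : set V) f x v : closed K -> K `<=` U ->
  (forall y, ~ K y -> f y = 0) -> C1 U f -> derivable f x v.
Proof.
move=> cK KU f0 Cf; have [/KU Ux|nKx] := pselect (K x); first exact: C1_derivable Cf Ux.
by apply: near_eq_derivable (vanish_near cK f0 nKx) _; exact: derivable_cst.
Qed.

Lemma continuous_derive_glue U (K : set V) f v : closed K -> K `<=` U ->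
  (forall y, ~ K y -> f y = 0) -> C1 U f -> continuous ('D_v f).
Proof.
move=> cK KU f0 Cf; apply: (continuous_glue cK KU) => [y nK|x].
  exact: vanish_derive cK f0 nK.
exact: C1_continuous_derive Cf.
Qed.

End ContinuouslyDifferentiable.

(** * Real powers and Young's inequality *)

Section Powers.
Context {R : realType}.

Lemma continuous_powR (a x : R) : 0 < x -> {for x, continuous (fun y => y `^ a)}.
Proof.
move=> x0; apply/differentiable_continuous/derivable1_diffP.
by have := is_derive1_powR a x0 => ?; exact: ex_derive.
Qed.

(** Off 0 this is the chain rule on each half-line. At 0 the difference quotient is at most [|h|],
    because [|h|^p <= |h|^2] for [|h| <= 1] and [p >= 2]. *)
Lemma is_derive_normr_powR (p x : R) : 2 <= p ->
  is_derive x 1 (fun y => `|y| `^ p) (p * (x * `|x| `^ (p - 2))).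
Proof.
move=> p2; have p0 : 0 < p by move: p2; lra.
have powE (y : R) : 0 < y -> y `^ (p - 1) = y * y `^ (p - 2).
  move=> y0; rewrite (_ : p - 1 = 1 + (p - 2)); last by ring.
  rewrite (@powRD _ y 1 (p - 2)); first by rewrite powRr1// ltW.
  by rewrite (gt_eqF y0) implybT.
have [x0|x0|->] := ltgtP x 0.
- have nx0 : 0 < - x by rewrite oppr_gt0.
  apply: (@near_eq_is_derive _ _ _ ((fun y : R => y `^ p) \o -%R)).
    by near=> y; rewrite /= ltr0_norm//; near: y; exact: lt_nbhsl.
  have dN : differentiable (-%R : R -> R) x by exact/derivable1_diffP/derivable_opp.
  split.
    apply/derivable1_diffP; apply: differentiable_comp => //.
    by apply/derivable1_diffP; have := is_derive1_powR p nx0 => ?; exact: ex_derive.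
  rewrite (derive_comp _ dN (is_derive1_powR p nx0)) derive_val powE// ltr0_norm//.
  by ring.
- apply: (@near_eq_is_derive _ _ _ (fun y : R => y `^ p)).
    by near=> y; rewrite /= gtr0_norm//; near: y; exact: lt_nbhsr.
  by rewrite gtr0_norm// -powE//; exact: is_derive1_powR.
- have : (fun h : R => h^-1 *: (`|h *: (1 : R^o) + 0 : R| `^ p - `|0 : R| `^ p)) @ 0^' --> (0 : R).
    apply/cvgrPdist_le => e e0; near=> h.
    have h0 : h != 0 by near: h; exact: nbhs_dnbhs_neq.
    have h1 : `|h| < 1 by near: h; exact: dnbhs0_lt.
    have he : `|h| < e by near: h; exact: dnbhs0_lt.
    rewrite sub0r normrN normr0 powR0 ?gt_eqF// subr0 addr0 [h *: 1]mulr1.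
    rewrite normrM normfV ler_pdivrMl ?normr_gt0// norm_powR// normr_id.
    rewrite (@le_trans _ _ (`|h| `^ 2))//.
      by rewrite ger_powR// normr_gt0 h0 ltW.
    by rewrite powR_mulrn// expr2 ler_wpM2l// ltW.
  rewrite mul0r mulr0 => c; split; first by apply/cvg_ex; exists 0.
  by apply: (cvg_lim _ c); exact: norm_hausdorff.
Unshelve. all: by end_near. Qed.

Lemma continuous_derive_normr_powR (p : R) : 2 <= p ->
  continuous (fun x : R => p * (x * `|x| `^ (p - 2))).
Proof.
move=> p2 x.
suff c1 : {for x, continuous (fun x : R => x * `|x| `^ (p - 2))}.
  exact: (continuousM (@cst_continuous _ _ p x) c1).
have [->|x0] := eqVneq x 0; last first.
  apply: continuousM; first exact: cvg_id.
  apply: (@continuous_comp _ _ _ (fun x : R => `|x|) (fun y => y `^ (p - 2))).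
    exact: norm_continuous.
  by apply: continuous_powR; rewrite normr_gt0.
suff L : h * `|h| `^ (p - 2) @[h --> (0 : R)] --> (0 : R).
  by rewrite /prop_for /continuous_at/= mul0r.
apply/cvgrPdist_le => e e0; near=> h.
have h1 : `|h| < 1 by near: h; apply: (@nbhs0_lt _ R^o).
have he : `|h| < e by near: h; apply: (@nbhs0_lt _ R^o).
rewrite sub0r normrN normrM (le_trans _ (ltW he))// ler_piMr// norm_powR// normr_id.
(* At [h = 0] the power is 0, or 1 when [p = 2]; the comparison of exponents used next is for a
   positive base. *)
have [->|h0] := eqVneq h 0.
  by rewrite normr0 /powR eqxx; case: (_ == 0).
rewrite -[leRHS](powRr0 `|h|); apply: ger_powR; last by rewrite subr_ge0.
by rewrite normr_gt0 h0 ltW.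
Unshelve. all: by end_near. Qed.

Lemma C1_normr_powR (V : normedModType R) (U : set V) (p : R) f : open U ->
  2 <= p -> C1 U f -> C1 U (fun x => `|f x| `^ p).
Proof.
move=> oU p2; apply: (C1_comp (phi := fun y => `|y| `^ p)
    (dphi := fun y => p * (y * `|y| `^ (p - 2)))) => // x _.
  exact: is_derive_normr_powR.
exact: continuous_derive_normr_powR.
Qed.

Lemma C1_powR (V : normedModType R) (U : set V) (a : R) f : open U ->
  (forall x, U x -> 0 < f x) -> C1 U f -> C1 U (fun x => f x `^ a).
Proof.
move=> oU f0; apply: (C1_comp (phi := fun y => y `^ a)
    (dphi := fun y => a * y `^ (a - 1))) => // x /f0 fx0.
  exact: is_derive1_powR.
apply: continuousM; first exact: cst_continuous.
exact: continuous_powR.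
Qed.

(** The left side is the tangent at [a] to the convex function [s^p], evaluated at [b]. It comes
    from the inequality for conjugate exponents [p] and [p / (p - 1)] applied to [b] and
    [a^(p-1)]. *)
Lemma young_powR (p a b : R) : 2 <= p -> 0 <= a -> 0 <= b ->
  p * a `^ (p - 1) * b - (p - 1) * a `^ p <= b `^ p.
Proof.
move=> p2 a0 b0; have p0 : 0 < p by move: p2; lra.
have p10 : 0 < p - 1 by move: p2; lra.
have q0 : 0 < p / (p - 1) by rewrite divr_gt0.
have := conjugate_powR b0 (powR_ge0 a (p - 1)) p0 q0.
rewrite -powRrM mulrCA divff ?mulr1 ?gt_eqF//.
have -> : p^-1 + (p / (p - 1))^-1 = 1 by field; rewrite !gt_eqF.
move=> /(_ erefl).
rewrite -(ler_pM2l p0) mulrDr invf_div => H.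
have E : p * (b `^ p / p) + p * (a `^ p * ((p - 1) / p)) =
   b `^ p + (p - 1) * a `^ p by field; rewrite gt_eqF.
by move: H; rewrite E; lra.
Qed.

End Powers.

(** * From iterated partial derivatives to C^1 and C^2 *)

Section SmoothFunctions.
Context {R : realType}.

Lemma near_eq_differentiable (V : normedModType R) (f g : V -> R) x :
  (\forall y \near x, f y = g y) -> differentiable f x -> differentiable g x.
Proof.
move=> fg df; have fgx : f x = g x := nbhs_singleton fg.
have gE : g \o shift x = cst (g x) + 'd f x +o_ 0 id.
  apply/eqaddoP => e e0; have /eqaddoP/(_ e e0) := diff_locally df.
  have := fg; rewrite (near_shift 0 x)/= subr0 => fg0.
  apply: filterS2 fg0 => h /= fgh.
  by rewrite !fctE/= fgh fgx.
have dE : 'd g x = 'd f x :> (V -> R) := diff_unique (diff_continuous df) gE.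
by apply/diff_locallyP; rewrite dE; split => //; exact: diff_continuous.
Qed.

Lemma C1_ext (V : normedModType R) (U : set V) (f g : V -> R) : open U ->
  (forall x, U x -> f x = g x) -> C1 U f -> C1 U g.
Proof.
move=> oU fg Cf.
have nfg x : U x -> \forall y \near x, f y = g y.
  by move=> Ux; apply: filterS (open_nbhs_nbhs (conj oU Ux)) => y /fg.
apply: (@C1_intro _ _ _ _ (fun v => 'D_v f)) => // [x Ux|x v Ux|x v Ux].
- exact: near_eq_differentiable (nfg x Ux) (C1_differentiable Cf Ux).
- by rewrite (near_eq_derive _ (nfg x Ux)).
- exact: C1_continuous_derive Cf Ux.
Qed.

(** Arbitrary fixed directions are allowed, so that a horizontal direction frozen at a point is
    covered. *)
Definition C2 (V : normedModType R) (U : set V) (f : V -> R) :=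
  C1 U f /\ forall v, C1 U ('D_v f).

Lemma derive_basis N (f : 'rV[R]_N -> R) x v : differentiable f x ->
  'D_v f x = \sum_k v 0 k * 'D_(delta_mx 0 k) f x.
Proof.
move=> df; rewrite {1}(row_sum_delta v) derive_dir_sum//.
by apply: eq_bigr => k _; rewrite derive_dirZ.
Qed.

Lemma continuous_at_sum (V : normedModType R) (I : finType) (F : I -> V -> R) x :
  (forall k, {for x, continuous (F k)}) ->
  {for x, continuous (fun y => \sum_k F k y)}.
Proof.
move=> cF; elim: (index_enum I) => [|k s IH].
  under [X in {for _, continuous X}]eq_fun do rewrite big_nil; exact: cst_continuous.
under [X in {for _, continuous X}]eq_fun do rewrite big_cons.
exact: (continuousD (cF k) IH).
Qed.

(** A partial derivative is continuous because [smooth_on] makes it differentiable; other directions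
    are expanded in the basis. *)
Lemma smooth_on_C1 N (U : set 'rV[R]_N) f : smooth_on U f -> C1 U f.
Proof.
move=> [oU sf]; apply: (@C1_intro _ _ U f
    (fun v x : 'rV[R]_N => \sum_k v 0 k * 'D_(delta_mx 0 k) f x)) => // [x Ux|x v Ux|x v Ux].
- exact: sf [::] x Ux.
- by apply: derive_basis; exact: sf [::] x Ux.
- apply: (@continuous_at_sum _ _ (fun k x => v 0 k * 'D_(delta_mx 0 k) f x)) => k.
  have ck := differentiable_continuous (sf [:: k] x Ux).
  exact: (continuousM (@cst_continuous _ _ (v 0 k) x) ck).
Qed.

(** The last index of the list is the one differentiated first, so appending an index shows that
    partial derivatives of smooth functions are smooth. *)
Lemma dpart_rcons N s k (f : 'rV[R]_N -> R) :
  dpart s (dpart [:: k] f) = dpart (rcons s k) f.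
Proof. by elim: s => //= l s ->. Qed.

Lemma smooth_on_C2 N (U : set 'rV[R]_N) f : smooth_on U f -> C2 U f.
Proof.
move=> sf; have [oU sdf] := sf; split=> [|v]; first exact: smooth_on_C1.
apply: (@C1_ext _ _ (fun x => \sum_k v 0 k * 'D_(delta_mx 0 k) f x) _ oU) => [x Ux|].
  by rewrite derive_basis//; exact: sdf [::] x Ux.
apply: (C1_sum oU) => k; apply: (C1M oU (C1_cst _ oU)).
apply: smooth_on_C1; split => // s x Ux.
by have := sdf (rcons s k) x Ux; rewrite -dpart_rcons.
Qed.

Lemma derive_powR (V : normedModType R) (d : V -> R) a x v : differentiable d x ->
  0 < d x -> 'D_v (fun x => d x `^ a) x = a * d x `^ (a - 1) * 'D_v d x.
Proof. by move=> dd d0; exact: derive_comp dd (is_derive1_powR a d0). Qed.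

Lemma C2_powR (V : normedModType R) (U : set V) (a : R) d : open U ->
  (forall x, U x -> 0 < d x) -> C2 U d -> C2 U (fun x => d x `^ a).
Proof.
move=> oU d0 [Cd CDd]; split=> [|v]; first exact: C1_powR.
apply: (@C1_ext _ _ (fun x => a * d x `^ (a - 1) * 'D_v d x) _ oU) => [x Ux|].
  by rewrite derive_powR//; [exact: C1_differentiable Cd Ux|exact: d0].
exact: (C1M oU (C1M oU (C1_cst a oU) (C1_powR (a - 1) oU d0 Cd)) (CDd v)).
Qed.

End SmoothFunctions.

(** * Horizontal vector fields *)

Section HorizontalFields.
Context {R : realType} {n h : nat} (L : 'M[R]_(h, n)).
Local Notation G := 'rV[R]_(2 * n + h).
Implicit Types (f g w : G -> R) (x : G) (m : 'I_(2 * n)) (i : 'I_n) (j : 'I_h).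

Lemma even_index_subproof i : (2 * i < 2 * n)%N.
Proof. by rewrite ltn_pmul2l. Qed.

(* 0-based: [ev i] and [od i] are the paper's coordinates [2i-1] and [2i]. *)
Definition ev i : 'I_(2 * n) := Ordinal (even_index_subproof i).

Lemma odd_index_subproof i : ((2 * i).+1 < 2 * n)%N.
Proof. by rewrite !mul2n ltn_Sdouble. Qed.

Definition od i : 'I_(2 * n) := Ordinal (odd_index_subproof i).

(* The coefficient of [d/dt_j] in [X_m]. *)
Definition tcoef m j x : R := 2^-1 * (zc x *m (Bmat L j)^T) 0 m.

Definition hdir m x : G := row_mx (delta_mx 0 m) (\row_j tcoef m j x).

Lemma row_mx0_delta (v : 'rV[R]_(2 * n)) (t : 'rV[R]_h) :
  row_mx v t = row_mx v 0 + \sum_j t 0 j *: (row_mx 0 (delta_mx 0 j) : G).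
Proof.
rewrite {1}(row_sum_delta t) -[v in LHS]addr0.
have -> : \sum_j t 0 j *: (row_mx 0 (delta_mx 0 j) : G) = row_mx 0 (\sum_j t 0 j *: delta_mx 0 j).
  elim/big_ind2 : _ => [|a b c e -> ->|j _]; first by rewrite row_mx0.
    by rewrite add_row_mx addr0.
  by rewrite scale_row_mx scaler0.
by rewrite add_row_mx add0r addr0.
Qed.

(** At a fixed point [X_m] is an ordinary directional derivative, so the sum, product and chain
    rules carry over; differentiability supplies linearity in the direction. *)
Lemma Xf_derive f m x : differentiable f x -> Xf L m f x = 'D_(hdir m x) f x.
Proof.
move=> df; rewrite /hdir row_mx0_delta derive_dirD// derive_dir_sum//.
by congr (_ + _); apply: eq_bigr => j _; rewrite derive_dirZ// mxE.
Qed.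

Lemma XfD f g m x : differentiable f x -> differentiable g x ->
  Xf L m (fun y => f y + g y) x = Xf L m f x + Xf L m g x.
Proof.
move=> df dg; rewrite !Xf_derive//; last exact: differentiableD.
exact: (deriveD (diff_derivable df) (diff_derivable dg)).
Qed.

Lemma XfM f g m x : differentiable f x -> differentiable g x ->
  Xf L m (fun y => f y * g y) x = f x * Xf L m g x + g x * Xf L m f x.
Proof.
move=> df dg; rewrite !Xf_derive//; last exact: differentiableM.
exact: (deriveM (diff_derivable df) (diff_derivable dg)).
Qed.

Lemma Xf_cst (c : R) m x : Xf L m (fun=> c) x = 0.
Proof. by rewrite Xf_derive ?derive_cst//; exact: differentiable_cst. Qed.

Lemma XfZ (c : R) f m x : differentiable f x ->
  Xf L m (fun y => c * f y) x = c * Xf L m f x.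
Proof. by move=> df; rewrite XfM ?Xf_cst ?mulr0 ?addr0//; exact: differentiable_cst. Qed.

Lemma XfN f m x : differentiable f x -> Xf L m (fun y => - f y) x = - Xf L m f x.
Proof.
by move=> df; under eq_fun do rewrite -mulN1r; rewrite XfZ// mulN1r.
Qed.

Lemma Xf_sum (I : finType) (f : I -> G -> R) m x :
  (forall k, differentiable (f k) x) ->
  differentiable (fun y => \sum_k f k y) x /\
  Xf L m (fun y => \sum_k f k y) x = \sum_k Xf L m (f k) x.
Proof.
move=> df; elim: (index_enum I) => [|k s [IHd IHX]].
  under eq_fun do rewrite big_nil; rewrite big_nil; split.
    exact: differentiable_cst.
  exact: Xf_cst.
under eq_fun do rewrite big_cons; rewrite big_cons -IHX; split.
  exact: differentiableD.
exact: XfD.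
Qed.

Lemma derive_coord N (x v : 'rV[R]_N) k : 'D_v (fun y : 'rV[R]_N => y 0 k) x = v 0 k.
Proof.
have := @derive_mx _ _ _ _ (fun y : 'rV[R]_N => y) x v (@derivable_id _ _ _ _).
by move=> /matrixP/(_ 0 k); rewrite mxE => <-; rewrite derive_id.
Qed.

Lemma zcE x m : zc x 0 m = x 0 (lshift h m).
Proof. by rewrite mxE. Qed.

Lemma tcE x j : tc x 0 j = x 0 (rshift (2 * n) j).
Proof. by rewrite mxE. Qed.

Lemma C1_coord N (U : set 'rV[R]_N) k : open U -> C1 U (fun y : 'rV[R]_N => y 0 k).
Proof.
move=> oU; apply: (@C1_intro _ _ U _ (fun v : 'rV[R]_N => cst (v 0 k))) => // [x _|x v _|x v _].
- exact: differentiable_coord.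
- exact: derive_coord.
- exact: cst_continuous.
Qed.

Lemma C1_zc (U : set G) m : open U -> C1 U (fun y => zc y 0 m).
Proof. by move=> oU; under eq_fun do rewrite zcE; exact: C1_coord. Qed.

Lemma C1_tc (U : set G) j : open U -> C1 U (fun y => tc y 0 j).
Proof. by move=> oU; under eq_fun do rewrite tcE; exact: C1_coord. Qed.

Lemma differentiable_zc m x : differentiable (fun y => zc y 0 m) x.
Proof. exact: (C1_differentiable (C1_zc m openT)). Qed.

Lemma differentiable_tc j x : differentiable (fun y => tc y 0 j) x.
Proof. exact: (C1_differentiable (C1_tc j openT)). Qed.

Lemma Xf_zc m m' x : Xf L m (fun y => zc y 0 m') x = (m == m')%:R.
Proof.
rewrite Xf_derive; last exact: differentiable_zc.
have -> : (fun y : G => zc y 0 m') = fun y => y 0 (lshift h m').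
  by apply/funext => y; rewrite zcE.
by rewrite derive_coord row_mxEl mxE eqxx/= eq_sym.
Qed.

Lemma Xf_tc m j x : Xf L m (fun y => tc y 0 j) x = tcoef m j x.
Proof.
rewrite Xf_derive; last exact: differentiable_tc.
have -> : (fun y : G => tc y 0 j) = fun y => y 0 (rshift (2 * n) j).
  by apply/funext => y; rewrite tcE.
by rewrite derive_coord row_mxEr mxE.
Qed.

Lemma lamNE j i : lamN L j i = L j i.
Proof. by rewrite /lamN (big_pred1 i). Qed.

Lemma Bmat_ev j i b : Bmat L j (ev i) b = (b == od i)%:R * L j i.
Proof.
have oi : odd (2 * i) = false by rewrite mul2n odd_double.
have di : ((2 * i) %/ 2)%N = i by rewrite mulKn.
rewrite mxE /= oi di lamNE andbT.
rewrite -val_eqE /=; case: eqP => [_|_]; first by rewrite mul1r.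
case: ifP => [/andP[/eqP E]|]; last by rewrite mul0r.
by have := congr1 odd E; rewrite /= oi => /esym/negbFE->.
Qed.

Lemma Bmat_od j i b : Bmat L j (od i) b = - ((b == ev i)%:R * L j i).
Proof.
have oi : odd (2 * i) = false by rewrite mul2n odd_double.
rewrite mxE /= oi andbF eqSS -val_eqE /= eq_sym.
case: eqP => [->|_]; last by rewrite mul0r oppr0.
by rewrite oi mulKn// lamNE mul1r.
Qed.

Lemma Bmat_skew j : (Bmat L j)^T = - Bmat L j.
Proof.
apply/matrixP => a b; rewrite !mxE.
case E : ((val b == (val a).+1) && ~~ odd a); last by case: ifP; rewrite ?opprK ?oppr0.
move: E => /andP[/eqP ba _].
by have -> : (val a == (val b).+1) = false by rewrite ba; apply/eqP; lia.
Qed.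

Lemma tcoefE m j x : tcoef m j x = 2^-1 * \sum_b zc x 0 b * Bmat L j m b.
Proof. by rewrite /tcoef mxE; congr (_ * _); apply: eq_bigr => b _; rewrite [_^T _ _]mxE. Qed.

Lemma tcoef_ev i j x : tcoef (ev i) j x = 2^-1 * L j i * zc x 0 (od i).
Proof.
rewrite tcoefE (bigD1 (od i))//= big1 => [|m /negbTE mi].
  by rewrite addr0 Bmat_ev eqxx mul1r mulrA mulrAC.
by rewrite Bmat_ev mi mul0r mulr0.
Qed.

Lemma tcoef_od i j x : tcoef (od i) j x = - (2^-1 * L j i * zc x 0 (ev i)).
Proof.
rewrite tcoefE (bigD1 (ev i))//= big1 => [|m /negbTE mi].
  by rewrite addr0 Bmat_od eqxx mul1r !mulrN mulrA mulrAC.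
by rewrite Bmat_od mi mul0r oppr0 mulr0.
Qed.

Lemma sum_z_tcoef j x : \sum_m zc x 0 m * tcoef m j x = 0.
Proof.
have E : \sum_m zc x 0 m * tcoef m j x = 2^-1 * (zc x *m (Bmat L j)^T *m (zc x)^T) 0 0.
  rewrite mxE mulr_sumr; apply: eq_bigr => m _.
  by rewrite /tcoef [_^T m 0]mxE mulrCA; congr (_ * _); rewrite mulrC.
have skew : (zc x *m (Bmat L j)^T *m (zc x)^T) 0 0 = - (zc x *m (Bmat L j)^T *m (zc x)^T) 0 0.
  have -> : forall M : 'M[R]_1, - M 0 0 = (- M^T) 0 0 by move=> M; rewrite !mxE.
  by rewrite !trmx_mul !trmxK Bmat_skew mulmxN mulNmx mulmxA.
by move/eqP: skew; rewrite E -addr_eq0 -mulr2n mulrn_eq0 => /eqP ->; rewrite mulr0.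
Qed.

(** Skew-symmetry gives [<B^(j) z, z> = 0], so the [t] components of [sum_m z_m X_m] cancel. This
    lets Euler's identity be expressed with horizontal derivatives. *)
Lemma sum_z_hdir x : \sum_m zc x 0 m *: hdir m x = row_mx (zc x) 0.
Proof.
have E : \sum_m zc x 0 m *: hdir m x =
    row_mx (\sum_m zc x 0 m *: delta_mx 0 m) (\sum_m zc x 0 m *: \row_j tcoef m j x).
  elim/big_ind3 : _ => [|a b c a' b' c' -> ->|m _]; first by rewrite row_mx0.
    by rewrite add_row_mx.
  by rewrite scale_row_mx.
rewrite E -row_sum_delta; congr row_mx; apply/rowP => j; rewrite summxE mxE.
by rewrite -[RHS](sum_z_tcoef j x); apply: eq_bigr => m _; rewrite !mxE.
Qed.

Lemma block_sum i (F : 'I_(2 * n) -> R) :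
  (forall m, (m %/ 2)%N != i -> F m = 0) -> \sum_m F m = F (ev i) + F (od i).
Proof.
move=> F0; rewrite (bigD1 (ev i))//= (bigD1 (od i))/=; last first.
  by rewrite -val_eqE /= eqn_leq ltnn.
rewrite big1 ?addr0// => m /andP[me mo]; apply: F0.
move: me mo; rewrite -!val_eqE /=.
by have := divn_eq m 2; have := ltn_pmod m (isT : (0 < 2)%N); lia.
Qed.

Lemma Xn_ev i f x : Xn L (2 * i) f x = Xf L (ev i) f x.
Proof. by rewrite /Xn (big_pred1 (ev i)). Qed.

Lemma Xn_od i f x : Xn L (2 * i).+1 f x = Xf L (od i) f x.
Proof. by rewrite /Xn (big_pred1 (od i)). Qed.

Lemma perp_ev i f x : perp L i f x 0 (ev i) = - Xf L (od i) f x.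
Proof. by rewrite mxE /= eqxx Xn_od. Qed.

Lemma perp_od i f x : perp L i f x 0 (od i) = Xf L (ev i) f x.
Proof. by rewrite mxE /= eqxx -[(_.+1 == _)%N]/(_ == _) (eqn_leq _.+1) ltnn /= Xn_ev. Qed.

Lemma perp_off i f x m : (m %/ 2)%N != i -> perp L i f x 0 m = 0.
Proof.
move=> /eqP mi; rewrite mxE; case: ifP => [/eqP mE|_].
  by case: mi; rewrite [nat_of_ord m]mE; lia.
by case: ifP => [/eqP mE|//]; case: mi; rewrite [nat_of_ord m]mE; lia.
Qed.

Lemma zblock_ev i x : zblock i x 0 (ev i) = zc x 0 (ev i).
Proof. by rewrite mxE /= mulKn// eqxx. Qed.

Lemma zblock_od i x : zblock i x 0 (od i) = zc x 0 (od i).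
Proof.
rewrite mxE /= (_ : ((2 * i).+1 %/ 2)%N = i) ?eqxx//.
by lia.
Qed.

Lemma zblock_off i x m : (m %/ 2)%N != i -> zblock i x 0 m = 0.
Proof. by move=> /negbTE mi; rewrite mxE mi. Qed.

End HorizontalFields.

(** * The divergence identity *)

Section Divergence.
Context {R : realType} {n h : nat} (L : 'M[R]_(h, n)).
Local Notation G := 'rV[R]_(2 * n + h).
Implicit Types (f g w : G -> R) (x : G) (m : 'I_(2 * n)) (i : 'I_n) (j : 'I_h).
Variables (U : set G) (oU : open U).

Lemma C1Z (c : R) f : C1 U f -> C1 U (fun y => c * f y).
Proof. by move=> Cf; exact: (C1M oU (C1_cst c oU) Cf). Qed.

Lemma C1N f : C1 U f -> C1 U (fun y => - f y).
Proof.
move=> Cf; have -> : (fun y => - f y) = fun y => -1 * f y by apply/funext => y; rewrite mulN1r.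
exact: C1Z.
Qed.

Lemma C1_tcoef m j : C1 U (tcoef L m j).
Proof.
have -> : tcoef L m j = fun x => 2^-1 * \sum_b Bmat L j m b * zc x 0 b.
  apply/funext => x; rewrite tcoefE; congr (_ * _).
  by apply: eq_bigr => b _; rewrite mulrC.
by apply: C1Z; apply: (C1_sum oU) => b; apply: C1Z; exact: C1_zc.
Qed.

Lemma C1_pz m w : C2 U w -> C1 U (pz m w).
Proof. by case=> _ Cw; exact: Cw. Qed.

Lemma C1_pt j w : C2 U w -> C1 U (pt j w).
Proof. by case=> _ Cw; exact: Cw. Qed.

Lemma C1_Xf m w : C2 U w -> C1 U (Xf L m w).
Proof.
move=> Cw; apply: (C1D oU (C1_pz m Cw)); apply: (C1_sum oU) => j.
exact: (C1M oU (C1_tcoef m j) (C1_pt j Cw)).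
Qed.

Lemma near_eq_Xf f g m x : (\forall y \near x, f y = g y) -> Xf L m f x = Xf L m g x.
Proof.
move=> fg; rewrite /Xf /pz (near_eq_derive _ fg); congr (_ + _).
by apply: eq_bigr => j _; rewrite /pt (near_eq_derive _ fg).
Qed.

(* Freeze the direction of [X_m'] at [x]; the remainder vanishes at [x]. *)
Lemma XfXf m m' w x : C2 U w -> U x ->
  Xf L m (Xf L m' w) x = 'D_(hdir L m x) ('D_(hdir L m' x) w) x
    + \sum_j Xf L m (tcoef L m' j) x * pt j w x.
Proof.
move=> Cw Ux; have [C1w CDw] := Cw.
pose r j y := (tcoef L m' j y - tcoef L m' j x) * pt j w y.
have dc j : differentiable (tcoef L m' j) x := C1_differentiable (C1_tcoef m' j) Ux.
have dc' j : differentiable (fun y => tcoef L m' j y - tcoef L m' j x) x.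
  by apply: differentiableB => //; exact: differentiable_cst.
have dp j : differentiable (pt j w) x := C1_differentiable (C1_pt j Cw) Ux.
have dr j : differentiable (r j) x by apply: differentiableM.
have dD : differentiable ('D_(hdir L m' x) w) x by exact: C1_differentiable (CDw _) Ux.
rewrite (@near_eq_Xf _ (fun y => 'D_(hdir L m' x) w y + \sum_j r j y)); last first.
  apply: filterS (open_nbhs_nbhs (conj oU Ux)) => y Uy.
  have dwy := C1_differentiable C1w Uy.
  rewrite /hdir row_mx0_delta derive_dirD// derive_dir_sum// -addrA -big_split/=.
  congr (_ + _); apply: eq_bigr => j _.
  by rewrite derive_dirZ// mxE -mulrDl subrKC.
have [drs Xrs] := Xf_sum L m dr.
rewrite XfD// Xrs Xf_derive//; congr (_ + _); apply: eq_bigr => j _.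
rewrite XfM// subrr mul0r add0r mulrC; congr (_ * _).
have dk := @differentiable_cst _ G _ (- tcoef L m' j x) x.
by rewrite (XfD _ _ (dc j) dk) Xf_cst addr0.
Qed.

Lemma Xf_tcoef_od i j x : Xf L (ev i) (tcoef L (od i) j) x = - (2^-1 * L j i).
Proof.
rewrite (_ : tcoef L (od i) j = fun y => (- (2^-1 * L j i)) * zc y 0 (ev i)); last first.
  by apply/funext => y; rewrite tcoef_od mulNr.
by rewrite XfZ ?Xf_zc ?eqxx ?mulr1//; exact: differentiable_zc.
Qed.

Lemma Xf_tcoef_ev i j x : Xf L (od i) (tcoef L (ev i) j) x = 2^-1 * L j i.
Proof.
rewrite (_ : tcoef L (ev i) j = fun y => (2^-1 * L j i) * zc y 0 (od i)); last first.
  by apply/funext => y; rewrite tcoef_ev.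
by rewrite XfZ ?Xf_zc ?eqxx ?mulr1//; exact: differentiable_zc.
Qed.

(** The second-order parts, in directions frozen at [x], agree by [derive_comm]. What remains are
    derivatives of the coefficients, [lambda / 2] and [- lambda / 2], whose difference is
    [lambda]. *)
Lemma Xf_commutator i w x : C2 U w -> U x ->
  Xf L (od i) (Xf L (ev i) w) x - Xf L (ev i) (Xf L (od i) w) x =
  \sum_j L j i * pt j w x.
Proof.
move=> Cw Ux; have [C1w CDw] := Cw.
rewrite !XfXf// derive_comm; last 3 first.
- by apply: filterS (open_nbhs_nbhs (conj oU Ux)) => y; exact: C1_differentiable C1w.
- exact: C1_differentiable (CDw _) Ux.
- exact: C1_differentiable (CDw _) Ux.
rewrite opprD addrACA subrr add0r -sumrB; apply: eq_bigr => j _.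
by rewrite Xf_tcoef_od Xf_tcoef_ev mulNr opprK -mulrDl; congr (_ * _); field.
Qed.

Lemma div_z w x : differentiable w x ->
  \sum_m Xf L m (fun y => w y * zc y 0 m) x =
  (2 * n)%:R * w x + \sum_m zc x 0 m * Xf L m w x.
Proof.
move=> dw; rewrite (eq_bigr (fun m => w x + zc x 0 m * Xf L m w x)) => [|m _].
  by rewrite big_split/= sumr_const card_ord mulr_natl.
by rewrite (XfM _ _ dw (differentiable_zc _ _)) Xf_zc eqxx mulr1.
Qed.

(** This is [<z^(i), grad w>]. It appears with opposite signs in [div_zblock] and [div_perp] and is
    never evaluated, only cancelled. *)
Definition block_pairing i w x :=
  zc x 0 (ev i) * Xf L (ev i) w x + zc x 0 (od i) * Xf L (od i) w x.

Lemma div_zblock i w x : differentiable w x ->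
  \sum_m Xf L m (fun y => w y * zblock i y 0 m) x = 2 * w x + block_pairing i w x.
Proof.
move=> dw; rewrite (block_sum (i := i)) => [|m mi]; last first.
  rewrite (_ : (fun y => _) = fun=> 0) ?Xf_cst//.
  by apply/funext => y; rewrite zblock_off// mulr0.
have -> : (fun y => w y * zblock i y 0 (ev i)) = fun y => w y * zc y 0 (ev i).
  by apply/funext => y; rewrite zblock_ev.
have -> : (fun y => w y * zblock i y 0 (od i)) = fun y => w y * zc y 0 (od i).
  by apply/funext => y; rewrite zblock_od.
rewrite !(XfM _ _ dw (differentiable_zc _ _)) !Xf_zc !eqxx !mulr1.
by rewrite /block_pairing mulr2n mulrDl mul1r addrACA.
Qed.

(** By the product rule, [t_j] multiplies the divergence of [perp w], which is a commutator. The
    other term is [<grad t_j, perp w>]; since [X_m t_j] is [tcoef m j], it is the block pairing with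
    factor [- lambda / 2]. *)
Lemma div_perp i j w x : C2 U w -> U x ->
  \sum_m Xf L m (fun y => tc y 0 j * perp L i w y 0 m) x =
  tc x 0 j * \sum_l L l i * pt l w x - 2^-1 * L j i * block_pairing i w x.
Proof.
move=> Cw Ux; rewrite (block_sum (i := i)) => [|m mi]; last first.
  rewrite (_ : (fun y => _) = fun=> 0) ?Xf_cst//.
  by apply/funext => y; rewrite perp_off// mulr0.
have -> : (fun y => tc y 0 j * perp L i w y 0 (ev i)) =
    fun y => tc y 0 j * (- Xf L (od i) w y).
  by apply/funext => y; rewrite perp_ev.
have -> : (fun y => tc y 0 j * perp L i w y 0 (od i)) =
    fun y => tc y 0 j * Xf L (ev i) w y.
  by apply/funext => y; rewrite perp_od.
have dX m : differentiable (Xf L m w) x := C1_differentiable (C1_Xf m Cw) Ux.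
have dNX : differentiable (fun y => - Xf L (od i) w y) x := differentiableN (dX _).
rewrite (XfM _ _ (differentiable_tc _ _) dNX) (XfM _ _ (differentiable_tc _ _) (dX _)).
rewrite (XfN _ _ (dX _)) !Xf_tc tcoef_ev tcoef_od -Xf_commutator//.
by rewrite /block_pairing; ring.
Qed.

(* [w d Z_d] for [w = d^(-p theta)], once [-p theta d^(-p theta - 1) grad d] is
   recognised as [grad w] (see [hardy_field_Zd]). *)
Definition hardy_field (ik : 'I_h -> 'I_n) w x : 'rV[R]_(2 * n) :=
  w x *: zc x + \sum_k w x *: zblock (ik k) x
  + 2 *: \sum_j \sum_k (invmx (Amat L ik) j k * tc x 0 j) *: perp L (ik k) w x.

Lemma hardy_fieldE ik w x m : hardy_field ik w x 0 m = w x * zc x 0 m +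
  \sum_k w x * zblock (ik k) x 0 m +
  2 * \sum_j \sum_k invmx (Amat L ik) j k * (tc x 0 j * perp L (ik k) w x 0 m).
Proof.
rewrite /hardy_field 2!mxE [in X in X + _]mxE; congr (_ + _ + _).
  by rewrite summxE; apply: eq_bigr => k _; rewrite mxE.
rewrite mxE; congr (_ * _); rewrite summxE; apply: eq_bigr => j _.
by rewrite summxE; apply: eq_bigr => k _; rewrite mxE mulrA.
Qed.

Lemma C1_zblock i m : C1 U (fun y => zblock i y 0 m).
Proof.
have -> : (fun y : G => zblock i y 0 m) = fun y : G => ((m %/ 2)%N == i)%:R * zc y 0 m.
  by apply/funext => y; rewrite mxE; case: ifP; rewrite ?mul1r ?mul0r.
by apply: C1Z; exact: C1_zc.
Qed.

Lemma C1_Xn k w : C2 U w -> C1 U (Xn L k w).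
Proof.
move=> Cw; have -> : Xn L k w = fun y => \sum_m ((val m == k)%:R * Xf L m w y).
  apply/funext => y; rewrite /Xn big_mkcond; apply: eq_bigr => m _.
  by case: ifP; rewrite ?mul1r ?mul0r.
by apply: (C1_sum oU) => m; apply: C1Z; exact: C1_Xf.
Qed.

Lemma C1_perp i m w : C2 U w -> C1 U (fun y => perp L i w y 0 m).
Proof.
move=> Cw; case E1 : (val m == 2 * i)%N.
  have -> : (fun y => perp L i w y 0 m) = fun y => - Xn L (2 * i).+1 w y.
    by apply/funext => y; rewrite mxE E1.
  by apply: C1N; exact: C1_Xn.
case E2 : (val m == (2 * i).+1)%N.
  have -> : (fun y => perp L i w y 0 m) = Xn L (2 * i) w.
    by apply/funext => y; rewrite mxE E1 E2.
  exact: C1_Xn.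
have -> : (fun y => perp L i w y 0 m) = cst 0.
  by apply/funext => y; rewrite mxE E1 E2.
exact: C1_cst.
Qed.

Lemma C1_hardy_field ik m w : C2 U w -> C1 U (fun y => hardy_field ik w y 0 m).
Proof.
move=> Cw; have [C1w _] := Cw; under eq_fun do rewrite hardy_fieldE.
apply: (C1D oU); first apply: (C1D oU).
- exact: (C1M oU C1w (C1_zc m oU)).
- by apply: (C1_sum oU) => k; exact: (C1M oU C1w (C1_zblock _ _)).
- apply: C1Z; apply: (C1_sum oU) => j; apply: (C1_sum oU) => k; apply: C1Z.
  exact: (C1M oU (C1_tc j oU) (C1_perp _ _ Cw)).
Qed.

(** The field [z] has divergence [2n], each of the [h] blocks adds 2, and [k] is the degree of
    homogeneity of [w], supplied through Euler's identity. *)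
Lemma div_hardy_field ik w x (k : R) : Amat L ik \in unitmx -> C2 U w -> U x ->
  \sum_m zc x 0 m * Xf L m w x + 2 * \sum_j tc x 0 j * pt j w x = k * w x ->
  \sum_m Xf L m (fun y => hardy_field ik w y 0 m) x = ((2 * n + 2 * h)%:R + k) * w x.
Proof.
move=> uA Cw Ux eul; have [C1w _] := Cw.
have dw := C1_differentiable C1w Ux.
have dz m : differentiable (fun y => w y * zc y 0 m) x.
  exact: differentiableM dw (differentiable_zc _ _).
have db i m : differentiable (fun y => w y * zblock i y 0 m) x.
  exact: differentiableM dw (C1_differentiable (C1_zblock _ _) Ux).
have dp i j m : differentiable (fun y => tc y 0 j * perp L i w y 0 m) x.
  exact: differentiableM (differentiable_tc _ _) (C1_differentiable (C1_perp _ _ Cw) Ux).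
have dAp i j m (c : R) : differentiable (fun y => c * (tc y 0 j * perp L i w y 0 m)) x.
  by apply: differentiableM => //; exact: differentiable_cst.
have XE m : Xf L m (fun y => hardy_field ik w y 0 m) x =
    Xf L m (fun y => w y * zc y 0 m) x +
    \sum_k Xf L m (fun y => w y * zblock (ik k) y 0 m) x +
    2 * \sum_j \sum_k invmx (Amat L ik) j k *
      Xf L m (fun y => tc y 0 j * perp L (ik k) w y 0 m) x.
  have [d1 X1] := Xf_sum L m (fun k => db (ik k) m).
  have d2 j := Xf_sum L m (fun k => dAp (ik k) j m (invmx (Amat L ik) j k)).
  have [d3 X3] := Xf_sum L m (fun j => (d2 j).1).
  under eq_fun do rewrite hardy_fieldE.
  rewrite XfD; last 2 first.
  - exact: differentiableD (dz m) d1.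
  - by apply: differentiableM => //; exact: differentiable_cst.
  rewrite (XfD _ _ (dz m) d1) X1 (XfZ _ _ _ d3) X3; congr (_ + _ * _).
  apply: eq_bigr => j _; rewrite (d2 j).2; apply: eq_bigr => l _.
  by rewrite (XfZ _ _ _ (dp _ _ _)).
have split3 (a b c : 'I_(2 * n) -> R) :
    \sum_m (a m + b m + c m) = \sum_m a m + \sum_m b m + \sum_m c m.
  by rewrite !big_split.
pose A := Amat L ik; pose B := \sum_k block_pairing (ik k) w x.
(* Here [A^-1 A = 1] isolates each [dw/dt_j] from the combinations that the commutators provide. *)
have S1 : \sum_j \sum_k invmx A j k * (tc x 0 j * \sum_l L l (ik k) * pt l w x) =
    \sum_j tc x 0 j * pt j w x.
  apply: eq_bigr => j _.
  under eq_bigr do rewrite mulrCA mulr_sumr.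
  rewrite -mulr_sumr exchange_big/=; congr (_ * _).
  rewrite (eq_bigr (fun l => (invmx A *m A) j l * pt l w x)) => [|l _].
    rewrite mulVmx// (bigD1 j)//= big1 ?addr0 => [|l /negbTE lj].
      by rewrite mxE eqxx mul1r.
    by rewrite mxE eq_sym lj mul0r.
  by rewrite mxE mulr_suml; apply: eq_bigr => k' _; rewrite [A _ _]mxE mulrA.
(* Here the diagonal of [A A^-1] gives every block the same weight [1/2]; after the outer factor 2
   the result is the [B] that [Sb] contributes with the other sign. *)
have S2 : \sum_j \sum_k invmx A j k * (2^-1 * L j (ik k) * block_pairing (ik k) w x) = 2^-1 * B.
  rewrite exchange_big mulr_sumr; apply: eq_bigr => k' _.
  rewrite (eq_bigr (fun j => (A k' j * invmx A j k') * (2^-1 * block_pairing (ik k') w x))) => [|j _].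
    rewrite -mulr_suml (_ : \sum_j _ = (A *m invmx A) k' k'); last by rewrite mxE.
    by rewrite mulmxV// mxE eqxx mul1r.
  by rewrite [A _ _]mxE; ring.
have Sb : \sum_m \sum_k Xf L m (fun y => w y * zblock (ik k) y 0 m) x =
    (2 * h)%:R * w x + B.
  rewrite exchange_big/= (eq_bigr (fun k => 2 * w x + block_pairing (ik k) w x)) => [|l _].
    by rewrite big_split/= sumr_const card_ord -mulr_natr natrM; congr (_ + _); ring.
  exact: div_zblock.
have Sc : \sum_m 2 * \sum_j \sum_k invmx A j k *
      Xf L m (fun y => tc y 0 j * perp L (ik k) w y 0 m) x =
    2 * (\sum_j tc x 0 j * pt j w x - 2^-1 * B).
  rewrite -mulr_sumr -S1 -S2 exchange_big/= -sumrB; congr (_ * _).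
  apply: eq_bigr => j _; rewrite exchange_big/= -sumrB; apply: eq_bigr => l _.
  by rewrite -mulr_sumr div_perp// mulrBr.
rewrite (eq_bigr _ (fun m _ => XE m)) split3 Sb Sc div_z// natrD !mulrDl -eul.
by field.
Qed.

End Divergence.

(** * Homogeneity and Euler's identity *)

Section Homogeneity.
Context {R : realType} {n h : nat} (L : 'M[R]_(h, n)).
Local Notation G := 'rV[R]_(2 * n + h).
Implicit Types (d w : G -> R) (x : G).

Lemma dilE (g : R) x : dil g x = g *: row_mx (zc x) 0 + g ^+ 2 *: row_mx 0 (tc x).
Proof. by rewrite !scale_row_mx !scaler0 add_row_mx addr0 add0r. Qed.

Lemma dil1 x : dil 1 x = x.
Proof. by rewrite /dil expr1n !scale1r hsubmxK. Qed.

(** Differentiate [d (dil g x) = g * d x] at [g = 1]: the curve [(g z, g^2 t)] has velocity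
    [(z, 2t)] there. *)
Lemma derive_euler d x : differentiable d x ->
  (forall g, 0 < g -> d (dil g x) = g * d x) ->
  'D_(row_mx (zc x) (2 *: tc x)) d x = d x.
Proof.
move=> dd hom.
set a : G := row_mx (zc x) 0; set b : G := row_mx 0 (tc x).
pose q (g : R) : G := g *: a + g ^+ 2 *: b.
have qE g : q g = dil g x by rewrite dilE.
have d1 : differentiable (fun g : R => g *: a) (1 : R) by exact: differentiableZl.
have dX : differentiable (fun g : R => g ^+ 2) (1 : R) by apply/derivable1_diffP; exact: exprn_derivable.
have d2 : differentiable (fun g : R => g ^+ 2 *: b) (1 : R) by exact: differentiableZl.
have dq : differentiable q (1 : R) by exact: differentiableD.
have E1 : 'd (fun g : R => g *: a) (1 : R) 1 = a.
  have did : differentiable (id : R -> R) (1 : R) by exact: ex_diff.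
  by have /(congr1 (fun F => F 1)) := diffZl a did; rewrite diff_val scale1r.
have E2 : 'd (fun g : R => g ^+ 2 *: b) (1 : R) 1 = 2 *: b.
  have /(congr1 (fun F => F 1)) := diffZl b dX; rewrite -(deriveE _ dX) => ->.
  by rewrite exp_derive expr1n -[LHS]/((2 * 1 * 1 : R) *: b) !mulr1.
have Dq : 'd q (1 : R) 1 = row_mx (zc x) (2 *: tc x).
  have D12 : 'd q (1 : R) 1 = 'd (fun g : R => g *: a) (1 : R) 1 +
      'd (fun g : R => g ^+ 2 *: b) (1 : R) 1.
    exact: (congr1 (fun F => F 1) (diffD d1 d2)).
  transitivity (a + 2 *: b); last first.
    by rewrite /a /b scale_row_mx scaler0 add_row_mx addr0 add0r.
  by rewrite D12; congr (_ + _).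
have q1 : q 1 = x by rewrite qE dil1.
have dq1 : differentiable d (q (1 : R)) by rewrite q1.
have := diff_comp dq dq1 => /(congr1 (fun F => F 1)) /=.
rewrite Dq q1 -!deriveE//; last exact: differentiable_comp.
move=> <-; rewrite (@near_eq_derive _ _ _ _ (fun g : R => g * d x)).
  by rewrite deriveMr ?derive_id ?mulr1//; exact: derivable_id.
near=> g; rewrite /= qE hom//.
by near: g; exact: lt_nbhsr.
Unshelve. all: by end_near. Qed.

Lemma euler_sum w x : differentiable w x ->
  \sum_m zc x 0 m * Xf L m w x + 2 * \sum_j tc x 0 j * pt j w x =
  'D_(row_mx (zc x) (2 *: tc x)) w x.
Proof.
move=> dw; rewrite row_mx0_delta derive_dirD// derive_dir_sum// -(sum_z_hdir L).
rewrite derive_dir_sum//; congr (_ + _).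
  by apply: eq_bigr => m _; rewrite derive_dirZ// Xf_derive.
rewrite mulr_sumr; apply: eq_bigr => j _; rewrite derive_dirZ// mulrA; congr (_ * _).
by rewrite [RHS]mxE.
Qed.

Lemma Xf_powR d a m x : differentiable d x -> 0 < d x ->
  Xf L m (fun y => d y `^ a) x = a * d x `^ (a - 1) * Xf L m d x.
Proof.
move=> dd d0; rewrite !Xf_derive ?derive_powR//.
apply: (@differentiable_comp _ _ _ _ d (fun y => y `^ a)) => //.
by apply/derivable1_diffP; have := is_derive1_powR a d0 => ?; exact: ex_derive.
Qed.

Lemma perp_powR d a i x : differentiable d x -> 0 < d x ->
  perp L i (fun y => d y `^ a) x = (a * d x `^ (a - 1)) *: perp L i d x.
Proof.
move=> dd d0; have XE k : Xn L k (fun y => d y `^ a) x = a * d x `^ (a - 1) * Xn L k d x.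
  by rewrite /Xn mulr_sumr; apply: eq_bigr => m _; rewrite Xf_powR.
apply/rowP => m; rewrite !mxE !XE.
by case: ifP => _; rewrite ?mulrN//; case: ifP => _//; rewrite mulr0.
Qed.

Lemma hardy_field_Zd (ik : 'I_h -> 'I_n) d (p theta : R) x : differentiable d x -> 0 < d x ->
  hardy_field L ik (fun y => d y `^ (- (p * theta))) x =
  (d x * d x `^ (- (p * theta))) *: Zd L ik p theta d x.
Proof.
move=> dd d0; set a := - (p * theta); have dn0 : d x != 0 by rewrite gt_eqF.
have dV : d x `^ (a - 1) = d x `^ a / d x.
  by rewrite powRB ?powRr1 ?ltW// dn0 implybT.
rewrite /hardy_field /Zd; set c := d x `^ a; rewrite !scalerDr scalerN.
congr (_ + _ + _).
- by rewrite scalerA mulrAC divff ?mul1r.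
- rewrite scaler_sumr; apply: eq_bigr => k _.
  by rewrite scalerA mulrAC divff ?mul1r.
rewrite -scaleNr scalerA !scaler_sumr; apply: eq_bigr => j _.
rewrite !scaler_sumr; apply: eq_bigr => k _.
rewrite perp_powR// dV !scalerA; congr (_ *: _); rewrite -/c /a.
by field.
Qed.

End Homogeneity.

(** * Integration *)

Section CompactlySupportedIntegrals.
Context {R : realType}.

(** The radius is fixed before the function, so that all integrands vanishing off [K] share one [M],
    as linearity of the integral requires. *)
Lemma compact_supported N (K : set 'rV[R]_N) : compact K ->
  exists2 M : R, 0 <= M & forall f : 'rV[R]_N -> R,
    (forall x, ~ K x -> f x = 0) -> supported f M.
Proof.
move=> /compact_bounded[M0 [_ KM]]; exists (`|M0| + 1); first by rewrite addr_ge0.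
move=> f f0 x Mx; apply: f0 => Kx.
have M01 : M0 < `|M0| + 1 by rewrite (le_lt_trans (ler_norm _))// ltrDl.
by have /= := KM _ M01 x Kx; rewrite leNgt Mx.
Qed.

Lemma intRN_lin N (M : R) (f g : 'rV[R]_N -> R) (c : R) : 0 <= M ->
  cont_supported f M -> cont_supported g M ->
  intRN (fun x => f x + c * g x) = intRN f + c * intRN g.
Proof. by move=> M0 cf cg; have [lin _] := intRN_linear_bounded N M0; exact: lin. Qed.

Lemma intRN_sum N (M : R) (I : finType) (f : I -> 'rV[R]_N -> R) : 0 <= M ->
  (forall k, cont_supported (f k) M) ->
  cont_supported (fun x => \sum_k f k x) M /\
  intRN (fun x => \sum_k f k x) = \sum_k intRN (f k).
Proof.
move=> M0 cf; elim: (index_enum I) => [|k s [IHc IHI]].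
  rewrite big_nil; under eq_fun do rewrite big_nil; rewrite intRN0; split=> //.
  by split=> [|x _ //]; exact: cst_continuous.
have E : (fun x => \sum_(j <- k :: s) f j x) = fun x => f k x + 1 * \sum_(j <- s) f j x.
  by apply/funext => x; rewrite big_cons mul1r.
rewrite E big_cons -IHI -[X in _ + X]mul1r; split; first exact: cont_supported_lin.
exact: intRN_lin M0 (cf k) IHc.
Qed.

Context {n h : nat} (L : 'M[R]_(h, n)).
Local Notation G := 'rV[R]_(2 * n + h).

Lemma row_mx_delta_l (m : 'I_(2 * n)) :
  row_mx (delta_mx 0 m) 0 = delta_mx 0 (lshift h m) :> G.
Proof.
apply/rowP => k; rewrite mxE [RHS]mxE; case: splitP => j kj; rewrite mxE.
  by rewrite -!val_eqE /= kj.
by rewrite -!val_eqE /= kj (_ : (2 * n + j == m)%N = false)//; have := ltn_ord m; lia.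
Qed.

Lemma row_mx_delta_r (j : 'I_h) :
  row_mx 0 (delta_mx 0 j) = delta_mx 0 (rshift (2 * n) j) :> G.
Proof.
apply/rowP => k; rewrite mxE [RHS]mxE; case: splitP => i ki; rewrite mxE.
  by rewrite -!val_eqE /= ki (_ : (_ == _)%N = false)//; have := ltn_ord i; lia.
by rewrite -!val_eqE /= ki eqn_add2l.
Qed.

Lemma derive_tcoef (m : 'I_(2 * n)) (j l : 'I_h) (x : G) :
  is_derive x (row_mx 0 (delta_mx 0 l) : G) (tcoef L m j) 0.
Proof.
have dt := C1_differentiable (C1_tcoef L openT m j) (I : setT x).
apply: DeriveDef; first exact: diff_derivable.
rewrite /derive; rewrite (_ : (fun _ => _) = cst 0); first exact: lim_cst.
apply/funext => k /=; rewrite /tcoef.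
suff -> : zc (k *: (row_mx 0 (delta_mx 0 l) : G) + x) = zc x by rewrite subrr scaler0.
by rewrite /zc linearD/= scale_row_mx row_mxKl scaler0 add0r.
Qed.

(* [X_m] only differentiates in directions along which its coefficients are
   constant, so it integrates to zero like a coordinate derivative. *)
Lemma intRN_Xf (m : 'I_(2 * n)) (f : G -> R) (M : R) : 0 <= M ->
  (forall x v, derivable f x v) -> cont_supported f M ->
  (forall v, continuous ('D_v f)) ->
  cont_supported (Xf L m f) M /\ intRN (Xf L m f) = 0.
Proof.
move=> M0 df cf cDf.
have cD v : cont_supported ('D_v f) M by split => //; exact: supported_derive cf.2.
have ct j : continuous (tcoef L m j : G -> R).
  by move=> x; exact: (C1_continuous (C1_tcoef L openT m j) (I : setT x)).
have cM j (g : G -> R) : cont_supported g M -> cont_supported (fun x => tcoef L m j x * g x) M.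
  move=> [cg sg]; split=> [x|x Mx]; last by rewrite sg// mulr0.
  exact: (continuousM (ct j x) (cg x)).
have E j : (fun x => tcoef L m j x * pt j f x) = 'D_(delta_mx 0 (rshift (2 * n) j)) (fun x => tcoef L m j x * f x).
  apply/funext => x; rewrite -row_mx_delta_r; have dt := derive_tcoef m j j x.
  have [dt1 dt2] := dt; rewrite [RHS](deriveM dt1 (df x _)) dt2.
  by rewrite [X in _ + X]mulr0 addr0.
have I0 j : intRN (fun x => tcoef L m j x * pt j f x) = 0.
  rewrite E; apply: (intRN_derive_basis M0); last 2 first.
  - exact: cM.
  - by rewrite -E; exact: (cM j _ (cD _)).1.
  move=> x; rewrite -row_mx_delta_r; have [dt1 _] := derive_tcoef m j j x.
  exact: derivableM dt1 (df x _).
have [cS IS] := intRN_sum M0 (fun j => cM j _ (cD (row_mx 0 (delta_mx 0 j) : G))).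
have XE : Xf L m f = fun x => pz m f x + 1 * \sum_j tcoef L m j x * pt j f x.
  by apply/funext => x; rewrite mul1r.
rewrite XE; split; first exact: cont_supported_lin (cD _) cS.
rewrite (intRN_lin 1 M0 (cD _) cS) IS big1 => [|j _]; last exact: I0.
rewrite mulr0 addr0 /pz row_mx_delta_l; apply: (intRN_derive_basis M0) => //.
Qed.

End CompactlySupportedIntegrals.

(** * The inequality *)

Section HardyInequality.
Context {R : realType}.

(* With [a = c |U| r^(-theta)] and [b = |T| r^(1-theta)] this is
   [b^p >= p a^(p-1) b - (p-1) a^p] combined with [k sg k = c]. *)
Lemma pointwise_hardy (p theta k U T r : R) : 2 <= p -> 0 < r ->
  0 <= `|T| `^ p / r `^ (p * (theta - 1))
    + (- `|k| `^ p) * (`|U| `^ p / r `^ (p * theta))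
    + (Num.sg k * `|k| `^ (p - 1)) *
      (p * k * `|U| `^ p * r `^ (- (p * theta))
       + p * (U * `|U| `^ (p - 2)) * (r * r `^ (- (p * theta))) * T).
Proof.
move=> p2 r0; have p0 : 0 < p by move: p2; lra.
have p10 : 0 < p - 1 by move: p2; lra.
have rn0 : r != 0 by rewrite gt_eqF.
set c := `|k|; set b := `|T| * r `^ (1 - theta); set a := c * (`|U| * r `^ (- theta)).
have c0 : 0 <= c by rewrite /c.
have b0 : 0 <= b by rewrite mulr_ge0// powR_ge0.
have a0 : 0 <= a by rewrite !mulr_ge0// powR_ge0.
have bE : b `^ p = `|T| `^ p / r `^ (p * (theta - 1)).
  rewrite /b powRM ?powR_ge0// -powRrM -powRN; congr (_ * _ `^ _); ring.
have wE : r `^ (- (p * theta)) = (r `^ (p * theta))^-1 by rewrite powRN.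
have aE q : a `^ q = c `^ q * (`|U| `^ q * r `^ (- theta * q)).
  by rewrite /a powRM ?mulr_ge0 ?powR_ge0// powRM ?powR_ge0// -powRrM.
have apE : a `^ p = c `^ p * (`|U| `^ p / r `^ (p * theta)).
  by rewrite aE -wE; congr (_ * (_ * _ `^ _)); ring.
have UE : `|U * `|U| `^ (p - 2)| = `|U| `^ (p - 1).
  rewrite normrM (ger0_norm (powR_ge0 _ _)) -[RHS]mulr_powRB1//.
  by congr (_ * _ `^ _); ring.
have rE : r * r `^ (- (p * theta)) = r `^ (- theta * (p - 1)) * r `^ (1 - theta).
  rewrite -{1}[r](powRr1 (ltW r0)) -!powRD ?rn0 ?implybT//; congr (_ `^ _); ring.
have ccE : c `^ p = c * c `^ (p - 1) by rewrite mulr_powRB1.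
have sgk : Num.sg k * k = c by rewrite /c normrEsg.
have := young_powR p2 a0 b0; rewrite bE apE.
set I1 := `|T| `^ p / _; set I2 := `|U| `^ p / _ => Y.
set V := U * _ in UE *; set s := Num.sg k; set e := c `^ (p - 1).
have e0 : 0 <= e by exact: powR_ge0.
(* Since [|V| = |U|^(p-1)], this term has absolute value at most [p a^(p-1) b]; [|s| <= 1] takes
   care of all signs, with [s = 0] when [k = 0]. *)
have lowT : - (p * a `^ (p - 1) * b) <= s * e * (p * V * (r * r `^ (- (p * theta))) * T).
  have -> : p * a `^ (p - 1) * b = p * e * (r * r `^ (- (p * theta))) * (`|V| * `|T|).
    by rewrite aE /b rE UE -/e; ring.
  have -> : s * e * (p * V * (r * r `^ (- (p * theta))) * T) =
      p * e * (r * r `^ (- (p * theta))) * (s * (V * T)) by ring.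
  rewrite -mulrN ler_wpM2l ?mulr_ge0 ?powR_ge0 ?(ltW p0) ?(ltW r0)//.
  rewrite -normrM lerNl -mulNr (le_trans (ler_norm _))//.
  rewrite [leLHS]normrM [X in X * _]normrN.
  by rewrite ler_piMl// /s normr_sg; case: (_ != 0).
have K : s * e * (p * k * `|U| `^ p * r `^ (- (p * theta))) = p * (c `^ p * I2).
  have -> : c `^ p = s * k * e by rewrite ccE /s sgk.
  by rewrite /I2 wE; ring.
(* The coefficients [-1] and [p] of [a^p] add up to the [p - 1] of Young's inequality. *)
rewrite mulrDr K mulNr; move: Y lowT; rewrite -/I2.
set X := c `^ p * I2; set Z := s * e * _; set P := p * _ * b; lra.
Qed.

End HardyInequality.

Theorem theorem4p4 (R : realType) (n h : nat) (L : 'M[R]_(h, n))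
  (ik : 'I_h -> 'I_n) (d : 'rV[R]_(2 * n + h) -> R) (p theta : R) :
  (h <= n)%N ->
  (forall j i, 0 <= L j i) ->
  row_free L ->
  Amat L ik \in unitmx ->
  hom_norm L d ->
  smooth_on (~` [set 0]) d ->
  2 <= p ->
  forall u : 'rV[R]_(2 * n + h) -> R,
  smooth_c (~` [set 0]) u ->
  intRN (fun x => `|hdot (gradG L u x) (Zd L ik p theta d x)| `^ p
                  / d x `^ (p * (theta - 1)))
  >= `|((2 * n + 2 * h)%:R - p * theta) / p| `^ p *
     intRN (fun x => `|u x| `^ p / d x `^ (p * theta)).
Proof.
move=> _ _ _ uA [_ [_ [dhom [dpos _]]]] sd p2 u [su [K [cK KU u0]]].
have p0 : 0 < p by move: p2; lra.
have pn0 : p != 0 by rewrite gt_eqF.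
set U := ~` [set 0] in sd su KU.
have [oU _] := sd.
have clK : closed K by apply: compact_closed cK; exact: norm_hausdorff.
have dU x : U x -> 0 < d x by move=> Ux; apply: dpos; apply/eqP.
have C2d := smooth_on_C2 sd; have C1d := C2d.1.
have [C1u C1Du] := smooth_on_C2 su.
pose w x := d x `^ (- (p * theta)).
have C2w : C2 U w by exact: C2_powR.
pose F := hardy_field L ik w.
pose g x := `|u x| `^ p.
have C1g : C1 U g by exact: C1_normr_powR.
have g0 x : ~ K x -> g x = 0 by move=> /u0; rewrite /g => ->; rewrite normr0 powR0.
pose V m x := g x * F x 0 m.
have C1V m : C1 U (V m) by exact: (C1M oU C1g (C1_hardy_field _ oU _ _ C2w)).
have V0 m x : ~ K x -> V m x = 0 by move=> /g0; rewrite /V => ->; rewrite mul0r.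
have [M M0 supp] := compact_supported cK.
have csV m : cont_supported (V m) M.
  split; last exact: supp (V0 m).
  by apply: (continuous_glue clK KU (V0 m)) => x Ux; exact: C1_continuous (C1V m) Ux.
have intV m : cont_supported (Xf L m (V m)) M /\ intRN (Xf L m (V m)) = 0.
  apply: (intRN_Xf L m M0) => // [x v|v].
    exact: derivable_glue clK KU (V0 m) (C1V m).
  exact: continuous_derive_glue clK KU (V0 m) (C1V m).
have [csD intD] := intRN_sum M0 (fun m => (intV m).1).
rewrite big1 in intD; last by move=> m _; exact: (intV m).2.
set T := fun x => hdot (gradG L u x) (Zd L ik p theta d x).
have hdotE (a b : 'rV[R]_(2 * n)) : hdot a b = \sum_m a 0 m * b 0 m.
  by rewrite /hdot mxE; apply: eq_bigr => m _; rewrite [_^T _ _]mxE.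
have Xu0 x m : ~ K x -> Xf L m u x = 0.
  move=> nK; rewrite /Xf /pz (vanish_derive _ clK u0 nK) add0r big1// => j _.
  by rewrite /pt (vanish_derive _ clK u0 nK) mulr0.
have T0 x : ~ K x -> T x = 0.
  by move=> nK; rewrite /T hdotE big1// => m _; rewrite mxE Xu0// mul0r.
(* Normalised so that the divergence of the field is [p k w]. *)
pose k := ((2 * n + 2 * h)%:R - p * theta) / p.
have FE x : U x -> F x = (d x * w x) *: Zd L ik p theta d x.
  by move=> Ux; apply: hardy_field_Zd; [exact: C1_differentiable C1d Ux|exact: dU].
have DE x : U x -> \sum_m Xf L m (V m) x =
    p * k * g x * w x + p * (u x * `|u x| `^ (p - 2)) * (d x * w x) * T x.
  move=> Ux; have dd := C1_differentiable C1d Ux.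
  have dg := C1_differentiable C1g Ux; have du := C1_differentiable C1u Ux.
  have dw := C1_differentiable C2w.1 Ux.
  have dF m := C1_differentiable (C1_hardy_field L oU ik m C2w) Ux.
  have Xg m : Xf L m g x = p * (u x * `|u x| `^ (p - 2)) * Xf L m u x.
    by rewrite !Xf_derive//; exact: derive_comp du (is_derive_normr_powR _ p2).
  have eul : \sum_m zc x 0 m * Xf L m w x + 2 * \sum_j tc x 0 j * pt j w x =
      - (p * theta) * w x.
    rewrite euler_sum// derive_powR//; last exact: dU.
    rewrite derive_euler//; last by move=> c c0; exact: dhom.
    rewrite -mulrA; congr (_ * _); have dx := dU x Ux.
    rewrite powRB; last by rewrite (gt_eqF dx) implybT.
    by rewrite powRr1 ?ltW// divfK// gt_eqF.
  rewrite (eq_bigr (fun m => g x * Xf L m (fun y => F y 0 m) x +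
      p * (u x * `|u x| `^ (p - 2)) * (F x 0 m * Xf L m u x))) => [|m _]; last first.
    by rewrite (XfM _ _ dg (dF m)) Xg; ring.
  rewrite big_split/= -!mulr_sumr (div_hardy_field oU uA C2w Ux eul); congr (_ + _).
    by rewrite /k; field.
  rewrite -[RHS]mulrA; congr (_ * _); rewrite FE// /T hdotE mulr_sumr; apply: eq_bigr => m _.
  by rewrite !mxE; ring.
set I1 := fun x => `|T x| `^ p / d x `^ (p * (theta - 1)).
set I2 := fun x => `|u x| `^ p / d x `^ (p * theta).
have absc y : {for y, continuous (fun s : R => `|s| `^ p)}.
  apply/differentiable_continuous/derivable1_diffP.
  by have := is_derive_normr_powR y p2 => ?; exact: ex_derive.
have cdp a x : U x -> {for x, continuous (fun y => (d y `^ a)^-1)}.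
  move=> Ux; apply: continuousV; first by rewrite gt_eqF// powR_gt0// dU.
  exact: C1_continuous (C1_powR a oU dU C1d) Ux.
have cI1 : cont_supported I1 M.
  have I10 x : ~ K x -> I1 x = 0.
    by move=> /T0; rewrite /I1 => ->; rewrite normr0 powR0// mul0r.
  split; last exact: supp I10.
  apply: (continuous_glue clK KU I10) => x Ux.
  (* Near [x], [Z_d] is the C^1 field [F] divided by the positive function [d w], so its continuity
     need not be derived from its own formula. *)
  have cT : {for x, continuous T}.
    apply: (@near_eq_continuous _ _ (fun y => \sum_m Xf L m u y * (F y 0 m * (d y * w y)^-1))).
      apply: filterS (open_nbhs_nbhs (conj oU Ux)) => y Uy.
      rewrite /T hdotE; apply: eq_bigr => m _; rewrite [in RHS]mxE FE//.
      congr (_ * _); rewrite mxE mulrAC divff ?mul1r//.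
      by rewrite mulf_neq0 ?gt_eqF ?powR_gt0 ?dU.
    apply: continuous_at_sum => m.
    have c1 := C1_continuous (C1_Xf L oU m (conj C1u C1Du)) Ux.
    have c2 := C1_continuous (C1_hardy_field L oU ik m C2w) Ux.
    have c3 : {for x, continuous (fun y => (d y * w y)^-1)}.
      apply: continuousV; first by rewrite mulf_neq0 ?gt_eqF ?powR_gt0 ?dU.
      exact: (continuousM (C1_continuous C1d Ux) (C1_continuous C2w.1 Ux)).
    exact: (continuousM c1 (continuousM c2 c3)).
  have cTp : {for x, continuous (fun y => `|T y| `^ p)}.
    exact: (@continuous_comp _ _ _ T (fun s => `|s| `^ p) _ cT (absc _)).
  exact: (continuousM cTp (cdp _ _ Ux)).
have cI2 : cont_supported I2 M.
  have I20 x : ~ K x -> I2 x = 0.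
    by move=> /g0; rewrite /I2 /g => ->; rewrite mul0r.
  split; last exact: supp I20.
  apply: (continuous_glue clK KU I20) => x Ux.
  exact: (continuousM (C1_continuous C1g Ux) (cdp _ _ Ux)).
(* The divergence term integrates to zero, so nonnegativity of this single integrand is the
   inequality. *)
have : 0 <= intRN (fun x => (I1 x + (- `|k| `^ p) * I2 x)
     + (Num.sg k * `|k| `^ (p - 1)) * \sum_m Xf L m (V m) x).
  apply: intRN_ge0 => x; have [Kx|nK] := pselect (K x).
    rewrite DE; last exact: KU.
    by apply: pointwise_hardy p2 _; exact/dU/KU.
  rewrite /I1 /I2 T0// u0// normr0 powR0// !mul0r mulr0 !add0r.
  rewrite big1 ?mulr0// => m _.
  rewrite /Xf /pz (vanish_derive _ clK (V0 m) nK) add0r big1// => j _.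
  by rewrite /pt (vanish_derive _ clK (V0 m) nK) mulr0.
rewrite (intRN_lin _ M0 _ csD); last exact: cont_supported_lin.
by rewrite (intRN_lin _ M0 cI1 cI2) intD mulr0 addr0 mulNr subr_ge0.
Qed.
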